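(* Consider the stochastic variational inequality problem SVI$(X,F)$, where $F$ is pseudomonotone-plus on $X$, with solution set $X^*\neq\emptyset$. Suppose that: (A1) for all $k\ge 0$, almost surely $\mathbb{E}[w_k\mid\mathcal F_k]=0$ and $\mathbb{E}[w_{k+1/2}\mid\mathcal F_{k+1/2}]=0$; (A2) there exists $\nu>0$ such that for all $k\ge 0$, almost surely $\mathbb{E}[\|w_k\|^2\mid\mathcal F_k]\le\nu^2$ and $\mathbb{E}[\|w_{k+1/2}\|^2\mid\mathcal F_{k+1/2}]\le\nu^2$; (A3) $\sum_{k=0}^\infty\gamma_k^2<\infty$; (A4) $\sum_{k=0}^\infty\gamma_k=\infty$; (A6) there exist $L_*,B_*>0$ such that $\|F(x)-F(y)\|_*\le L_*\|x-y\|$ and $\|F(x)\|_*\le B_*/2$ for all $x,y\in X$; (A7) there exists $\nu_*>0$ such that for all $k\ge0$, $\mathbb{E}[\|w_k\|_*^2\mid\mathcal F_k]\le\nu_*^2$ and $\mathbb{E}[\|w_{k+1/2}\|_*^2\mid\mathcal F_{k+1/2}]\le\nu_*^2$. Additionally let $\beta>0$ and $c>0$ be chosen such that $\theta/2-1/c\ge0$. Let $\{x_k\}$ be a sequence of iterates generated by the mirror-prox scheme (MPSA). Then, almost surely, $\{x_k\}$ is bounded and any limit point of $\{x_k\}$ is a solution of SVI$(X,F)$.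
   Context: Let $X\subseteq\mathbb{R}^n$ be nonempty, closed and convex, $\xi:\Omega\to\mathbb{R}^d$ a random vector on a probability space, $F(x;\omega):=F(x,\xi(\omega))\in\mathbb{R}^n$ and $F(x):=\mathbb{E}[F(x;\omega)]$ (componentwise). SVI$(X,F)$ is the problem of finding $x^*\in X$ with $(x-x^* )^TF(x^* )\ge 0$ for all $x\in X$; its solution set is $X^*$. $\|\cdot\|$ is a norm on $\mathbb{R}^n$, with dual norm $\|x\|_*:=\sup\{z^Tx:\|z\|\le1\}$. Prox function: $s$ is a strongly convex differentiable function and $V(x,z):=s(z)-[s(x)+\nabla s(x)^T(z-x)]$. There is a scalar $\theta\ge1$ with $V(x,z)\ge\frac{\theta}{2}\|x-z\|^2$. It is assumed that $\nabla s$ is Lipschitz continuous with a positive constant $L_V$, with $V(x,z)\le L_V^2\|x-z\|^2$. Define $\mathbf P_X(x,r):=\arg\min_{z\in X}\big(r^Tz+V(x,z)\big)$. Mirror-prox stochastic approximation scheme (MPSA): given $x_0\in X$ and a positive diminishing steplength sequence $\{\gamma_k\}$, for $k\ge0$, $$x_{k+1/2}:=\mathbf P_X(x_k,\gamma_kF(x_k;\omega_k)),\qquad x_{k+1}:=\mathbf P_X(x_k,\gamma_kF(x_{k+1/2};\omega_{k+1/2})),$$ where $\omega_k,\omega_{k+1/2}$ are the samples drawn at iteration $k$, $w_k:=F(x_k;\omega_k)-F(x_k)$ and $w_{k+1/2}:=F(x_{k+1/2};\omega_{k+1/2})-F(x_{k+1/2})$. The histories are $\mathcal F_k:=\sigma\{x_0,\omega_0,\omega_{1/2},\omega_1,\dots,\omega_{k-1/2}\}$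 and $\mathcal F_{k+1/2}:=\sigma(\mathcal F_k\cup\{\omega_k\})$. A continuous map $F$ is pseudomonotone on $X$ if for all $x,y\in X$, $(x-y)^TF(y)\ge0\Rightarrow(x-y)^TF(x)\ge0$. It is pseudomonotone-plus on $X$ if it is pseudomonotone on $X$ and for all $x,y\in X$, [$(x-y)^TF(y)\ge 0$ and $(x-y)^TF(x)=0$] implies $F(x)=F(y)$. *)

(* Defs.v *)
From HB Require Import structures.
From mathcomp Require Import all_boot all_order all_algebra.
From mathcomp Require Import all_classical all_reals all_analysis.

Set Implicit Arguments.
Unset Strict Implicit.
Unset Printing Implicit Defensive.

Import Order.TTheory GRing.Theory Num.Theory.
Import numFieldNormedType.Exports.

Local Open Scope classical_set_scope.
Local Open Scope ring_scope.

(* MathComp-Analysis.  R^n is 'rV[R]_n with its library topology.  The norm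
   ||.|| is an arbitrary norm N, unrelated to the library's sup norm `|.|;
   topological notions (closed, differentiable, Borel, limit points) do not
   depend on this choice in finite dimension. *)

Section Euclidean.
Context {R : realType} {n : nat}.
Implicit Types (N : 'rV[R]_n -> R) (X : set 'rV[R]_n) (F : 'rV[R]_n -> 'rV[R]_n).

Definition dot (u v : 'rV[R]_n) : R := \sum_i u 0 i * v 0 i.

Definition is_norm N : Prop :=
  [/\ forall x, N x = 0 -> x = 0,
      forall (a : R) x, N (a *: x) = `|a| * N x
    & forall x y, N (x + y) <= N x + N y].

Definition dual_norm N (x : 'rV[R]_n) : R := sup [set dot z x | z in [set z | N z <= 1]].

Definition SVI X F : set 'rV[R]_n :=
  [set xs | X xs /\ forall x, X x -> 0 <= dot (x - xs) (F xs)].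

Definition pseudomonotone X F : Prop :=
  {within X, continuous F} /\
  forall x y, X x -> X y -> 0 <= dot (x - y) (F y) -> 0 <= dot (x - y) (F x).

Definition pseudomonotone_plus X F : Prop :=
  pseudomonotone X F /\
  forall x y, X x -> X y ->
    0 <= dot (x - y) (F y) -> dot (x - y) (F x) = 0 -> F x = F y.

Definition grad (s : 'rV[R]_n -> R) (x : 'rV[R]_n) : 'rV[R]_n :=
  \row_j 'D_(delta_mx 0 j) s x.

Definition strongly_convex N X (s : 'rV[R]_n -> R) : Prop :=
  exists2 mu : R, 0 < mu &
    forall x y (t : R), X x -> X y -> 0 <= t <= 1 ->
      s (t *: x + (1 - t) *: y) <=
        t * s x + (1 - t) * s y - mu / 2 * t * (1 - t) * N (x - y) ^+ 2.

Definition Vdist (s : 'rV[R]_n -> R) (x z : 'rV[R]_n) : R :=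
  s z - (s x + dot (grad s x) (z - x)).

(* The set of minimizers; strong convexity makes it a singleton. *)
Definition prox X (s : 'rV[R]_n -> R) (x r : 'rV[R]_n) : set 'rV[R]_n :=
  [set z | X z /\
     forall y, X y -> dot r z + Vdist s x z <= dot r y + Vdist s x y].

End Euclidean.

(* R^n equipped with its Borel sigma-algebra. *)
Notation borel_rV R n := (g_sigma_algebraType (@open 'rV[R]_n)).

Section Probability.
Context {R : realType} {dT : measure_display} {T : measurableType dT}.

(* g is a version of E[f | G], where G is a sub-sigma-algebra of T. *)
Definition is_condexp (P : probability T R) (G : set (set T)) (f g : T -> R) : Prop :=
  [/\ P.-integrable setT (EFin \o f),
      P.-integrable setT (EFin \o g),
      forall B : set R, measurable B -> G (g @^-1` B)
    & forall A, G A ->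
        (\int[P]_(t in A) (g t)%:E = \int[P]_(t in A) (f t)%:E)%E].

Definition condexp_eq0 (P : probability T R) G (f : T -> R) : Prop :=
  exists2 g, is_condexp P G f g & {ae P, forall t, g t = 0}.

Definition condexp_le (P : probability T R) G (f : T -> R) (c : R) : Prop :=
  exists2 g, is_condexp P G f g & {ae P, forall t, g t <= c}.

End Probability.

Section Scheme.
Context {R : realType} {n d : nat} {dO dT : measure_display}
        {Omega : measurableType dO} {T : measurableType dT}.

(* F(x) = E[F(x; .)], componentwise. *)
Definition mean_map (P : probability Omega R) (xi : Omega -> 'rV[R]_d)
    (Fs : 'rV[R]_n -> 'rV[R]_d -> 'rV[R]_n) (x : 'rV[R]_n) : 'rV[R]_n :=
  \row_j fine 'E_P[fun o => Fs x (xi o) 0 j].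

(* The samples omega_k and omega_{k+1/2} are om k and omh k. *)
Definition hist (x0 : T -> 'rV[R]_n) (om omh : nat -> T -> Omega) (k : nat) :
    set (set T) :=
  <<s preimage_set_system setT (x0 : T -> borel_rV R n) measurable `|`
      \bigcup_(i in [set i | (i < k)%N])
        (preimage_set_system setT (om i) measurable `|`
         preimage_set_system setT (omh i) measurable) >>.

Definition hist_half (x0 : T -> 'rV[R]_n) (om omh : nat -> T -> Omega) (k : nat) :
    set (set T) :=
  <<s hist x0 om omh k `|` preimage_set_system setT (om k) measurable >>.

(* x k and xh k are the iterates x_k and x_{k+1/2}. *)
Definition MPSA (X : set 'rV[R]_n) (s : 'rV[R]_n -> R) (xi : Omega -> 'rV[R]_d)
    (Fs : 'rV[R]_n -> 'rV[R]_d -> 'rV[R]_n) (gamma : nat -> R)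
    (om omh : nat -> T -> Omega) (x xh : nat -> T -> 'rV[R]_n) : Prop :=
  (forall t, X (x 0%N t)) /\
  forall k t,
    prox X s (x k t) (gamma k *: Fs (x k t) (xi (om k t))) (xh k t) /\
    prox X s (x k t) (gamma k *: Fs (xh k t) (xi (omh k t))) (x k.+1 t).

(* w_k (resp. w_{k+1/2}) is obtained with y := x k, o := om k
   (resp. y := xh k, o := omh k). *)
Definition noise (P : probability Omega R) (xi : Omega -> 'rV[R]_d)
    (Fs : 'rV[R]_n -> 'rV[R]_d -> 'rV[R]_n)
    (y : T -> 'rV[R]_n) (o : T -> Omega) (t : T) : 'rV[R]_n :=
  Fs (y t) (xi (o t)) - mean_map P xi Fs (y t).

End Scheme.

(* Main.v *)
Require Import Defs.
From HB Require Import structures.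
From mathcomp Require Import all_boot all_order all_algebra.
From mathcomp Require Import all_classical all_reals all_analysis.
From mathcomp Require Import measurable_realfun ring lra.

Set Implicit Arguments.
Unset Strict Implicit.
Unset Printing Implicit Defensive.

Import Order.TTheory GRing.Theory Num.Theory.
Import numFieldNormedType.Exports.

Local Open Scope classical_set_scope.
Local Open Scope ring_scope.

(** Along one trajectory put V_k(y) := V(x_k, y).  The optimality conditions of the
    two prox steps give, for every solution y,

      V_(k+1)(y) <= V_k(y) - gamma_k F(x_(k+1/2)) . (x_(k+1/2) - y)
                   - ||x_k - x_(k+1/2)||^2 / 4 + gamma_k w_(k+1/2) . (y - x_k) + e_k

    with e_k of order gamma_k^2 (1 + ||w_k||_*^2 + ||w_(k+1/2)||_*^2)
    ([mirror_prox_step]).  Pseudomonotonicity makes the first subtracted term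
    nonnegative, and the second-moment bounds with summable squared steplengths
    make the series of e_k almost surely convergent.  Since x_k rather than
    x_(k+1/2) appears in the noise term, this term is a martingale increment with a
    weight known before the sample is drawn.

    The initial point need not be integrable, so the noise term has to be
    controlled without bounding moments of x_k.  A series of martingale increments
    with summable variances converges almost surely ([martingale_series_cvg],
    through Kolmogorov's maximal inequality), hence so does the series of
    gamma_k phi_k w_(k+1/2), coordinate by coordinate, for every bounded weight
    phi_k determined by x_k ([weighted_noise_cvg]).  Three kinds of weights are
    enough.

    - The coordinates of (y - x_k) / (1 + V_k(y)) turn the inequality into
      1 + V_(k+1)(y) <= (1 + V_k(y)) (1 + d_k) + e_k with convergent series of d_k and e_k, so
      that the trajectory is bounded ([trajectory_bounded]).
    - The weight 1 and the truncated coordinates of x_k; on a bounded trajectory a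
      truncation at a high enough level is inactive, so the series of
      gamma_k w_(k+1/2) . (y - x_k) converges simultaneously for all y, on one event
      of probability one.

    The rest is deterministic: V_k(y) converges for every solution y, and the
    subtracted terms are summable.  As the steplengths are not summable, some
    cluster point z satisfies F(z) . (z - y) = 0; pseudomonotonicity-plus then gives
    F(z) = F(y), which makes z a solution ([SVI_of_gap0]).  Now V_k(z) converges and
    is frequently small, so it tends to 0: the whole trajectory converges to z
    ([trajectory_cvg]), and z is its only limit point.

    Predictability of the weights requires the iterates to be measurable for the
    histories.  It follows by induction from the Lipschitz dependence of the prox
    mapping on its arguments ([prox_lipschitz], [iterates_adapted]). *)

(** * Norms on a finite-dimensional space *)

Section Norms.
Context {R : realType} {n : nat}.
Implicit Types u v x y z : 'rV[R]_n.

Lemma dotDl u v z : dot (u + v) z = dot u z + dot v z.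
Proof. by rewrite /dot -big_split; apply: eq_bigr => i _; rewrite mxE mulrDl. Qed.

Lemma dotZl a u v : dot (a *: u) v = a * dot u v.
Proof. by rewrite /dot mulr_sumr; apply: eq_bigr => i _; rewrite mxE mulrA. Qed.

Lemma dotC u v : dot u v = dot v u.
Proof. by apply: eq_bigr => i _; rewrite mulrC. Qed.

Lemma dotDr u v z : dot u (v + z) = dot u v + dot u z.
Proof. by rewrite !(dotC u) dotDl. Qed.

Lemma dotZr a u v : dot u (a *: v) = a * dot u v.
Proof. by rewrite !(dotC u) dotZl. Qed.

Lemma dotNl u v : dot (- u) v = - dot u v.
Proof. by rewrite -scaleN1r dotZl mulN1r. Qed.

Lemma dotNr u v : dot u (- v) = - dot u v.
Proof. by rewrite !(dotC u) dotNl. Qed.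

Definition dotE := (dotDl, dotDr, dotNl, dotNr, dotZl, dotZr).

Lemma dot0l u : dot 0 u = 0.
Proof. by rewrite -(scale0r 0) dotZl mul0r. Qed.

Lemma dot_delta u i : dot (delta_mx 0 i) u = u 0 i.
Proof.
rewrite /dot (bigD1 i) //= mxE !eqxx mul1r big1 ?addr0 // => j ji.
by rewrite mxE eqxx (negbTE ji) mul0r.
Qed.

Lemma normr_coord u i : `|u 0 i| <= `|u|.
Proof. by rewrite [leRHS]/Num.norm /= mx_normrE; apply: (le_bigmax _ _ (0, i)). Qed.

Lemma normr_row_lt u e : 0 < e -> (forall i, `|u 0 i| < e) -> `|u| < e.
Proof.
move=> e0 h; rewrite [ltLHS]/Num.norm /= mx_normrE.
by apply: bigmax_lt => // -[i j] _ /=; rewrite (ord1 i).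
Qed.

Lemma dot_le_norm u v : `|dot u v| <= n%:R * `|u| * `|v|.
Proof.
apply: le_trans (ler_norm_sum _ _ _) _.
apply: (@le_trans _ _ (\sum_(i < n) `|u| * `|v|)).
  by apply: ler_sum => i _; rewrite normrM ler_pM ?normr_ge0 ?normr_coord.
by rewrite sumr_const card_ord -mulrA mulr_natl.
Qed.

Context (N : 'rV[R]_n -> R).
Hypothesis normN : is_norm N.

Lemma is_norm0 : N 0 = 0.
Proof. by case: normN => _ hZ _; rewrite -(scale0r 0) hZ normr0 mul0r. Qed.

Lemma is_normN x : N (- x) = N x.
Proof. by case: normN => _ hZ _; rewrite -scaleN1r hZ normrN1 mul1r. Qed.

Lemma is_normD x y : N (x + y) <= N x + N y.
Proof. by case: normN. Qed.

Lemma is_normZ a x : N (a *: x) = `|a| * N x.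
Proof. by case: normN. Qed.

Lemma is_norm_ge0 x : 0 <= N x.
Proof.
have := is_normD x (- x); rewrite subrr is_norm0 is_normN; lra.
Qed.

Lemma is_norm_eq0 x : N x = 0 -> x = 0.
Proof. by case: normN => h _ _; apply: h. Qed.

Lemma is_normB x y : N (x - y) = N (y - x).
Proof. by rewrite -opprB is_normN. Qed.

Lemma is_norm_upper : exists2 C : R, 0 < C & forall x, N x <= C * `|x|.
Proof.
pose S : R := \sum_(i < n) N (delta_mx 0 i).
have S0 : 0 <= S by apply: sumr_ge0 => i _; exact: is_norm_ge0.
exists (1 + S); first lra.
move=> x; apply: (@le_trans _ _ (S * `|x|)); last first.
  by rewrite ler_wpM2r // lerDr.
rewrite [in leLHS](row_sum_delta x) /S mulr_suml.
elim/big_ind2: _ => [|a a' b b' h1 h2|i _]; first by rewrite is_norm0.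
  by apply: le_trans (is_normD _ _) _; exact: lerD.
by rewrite is_normZ mulrC ler_wpM2l ?is_norm_ge0 ?normr_coord.
Qed.

Lemma is_norm_lower : exists2 C : R, 0 < C & forall x, `|x| <= C * N x.
Proof.
have [C C0 hC] := is_norm_upper.
pose S := [set x : 'rV[R]_n | `|x| = 1].
have [Se|] := pselect (S !=set0); last first.
  move=> Se; exists 1 => // x; have [->|x0] := eqVneq x 0.
    by rewrite normr0 mul1r is_norm_ge0.
  exfalso; apply: Se; exists (`|x|^-1 *: x).
  by rewrite /S /= normrZ normfV normr_id mulVf // normr_eq0.
have cN : continuous N.
  move=> x; apply/(@cvgrPdist_lt _ _ _ (nbhs x) (nbhs_filter x)) => e e0.
  apply/nbhs_ballP; exists (e / C) => [|y]; first exact: divr_gt0.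
  rewrite -ball_normE /= => xy.
  have h1 := is_normD (x - y) y; have h2 := is_normD (y - x) x.
  move: h1 h2; rewrite !subrK (is_normB y) => h1 h2.
  have := hC (x - y); rewrite ltr_pdivlMr // mulrC in xy.
  by move=> h3; rewrite ltr_norml; lra.
have cS : compact S.
  apply: bounded_closed_compact.
    by exists 1; split => // M M1 x /= ->; exact: ltW.
  have -> : S = (fun x : 'rV[R]_n => `|x|) @^-1` [set 1] by [].
  apply: preimage_closed; last exact: closed_eq.
  by move=> x _; exact: (@norm_continuous R 'rV[R]_n).
have [c /set_mem cS1 cmin] := EVT_min_rV Se cS (continuous_subspaceT cN).
have Nc : 0 < N c.
  rewrite lt_def is_norm_ge0 andbT; apply/eqP => /is_norm_eq0 c0.
  by move: cS1; rewrite /S /= c0 normr0 => /esym/eqP; rewrite oner_eq0.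
exists (N c)^-1; first by rewrite invr_gt0.
move=> x; have [->|x0] := eqVneq x 0.
  by rewrite normr0 mulr_ge0 ?is_norm_ge0 ?invr_ge0 ?ltW.
have nx : 0 < `|x| by rewrite normr_gt0.
have : S (`|x|^-1 *: x).
  by rewrite /S /= normrZ normfV normr_id mulVf // normr_eq0.
move=> /mem_set/cmin; rewrite is_normZ normfV normr_id.
by rewrite ler_pdivlMl // mulrC ler_pdivlMl // mulrC.
Qed.

Let dual_ubound u : has_sup [set dot z u | z in [set z | N z <= 1]].
Proof.
have [C C0 hC] := is_norm_lower.
split; first by exists (dot 0 u), 0 => //=; rewrite is_norm0.
exists (n%:R * C * `|u|) => _ [z /= hz <-].
apply: le_trans (ler_norm _) _; apply: le_trans (dot_le_norm _ _) _.
rewrite ler_wpM2r // ler_wpM2l //; apply: le_trans (hC z) _.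
by rewrite ger_pMr.
Qed.

Lemma dual_norm_ge0 u : 0 <= dual_norm N u.
Proof.
rewrite -[leLHS](dot0l u); apply: ub_le_sup; first exact: (dual_ubound u).2.
by exists 0 => //=; rewrite is_norm0.
Qed.

Lemma dot_le_dual z u : dot z u <= N z * dual_norm N u.
Proof.
have [->|z0] := eqVneq z 0; first by rewrite dot0l is_norm0 mul0r.
have Nz : 0 < N z.
  rewrite lt_def is_norm_ge0 andbT; apply/eqP => /is_norm_eq0 h.
  by rewrite h eqxx in z0.
rewrite mulrC -ler_pdivrMr // mulrC -dotZl; apply: ub_le_sup.
  exact: (dual_ubound u).2.
exists ((N z)^-1 *: z) => //=.
by rewrite is_normZ normfV ger0_norm ?mulVf ?gt_eqF // ltW.
Qed.

Lemma dual_norm_le u a : (forall z, N z <= 1 -> dot z u <= a) -> dual_norm N u <= a.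
Proof. by move=> h; apply: sup_le_ub; [exact: (dual_ubound u).1|move=> _ [z /= hz <-]; exact: h]. Qed.

Lemma dual_normD u v : dual_norm N (u + v) <= dual_norm N u + dual_norm N v.
Proof.
apply: dual_norm_le => z hz; rewrite dotDr; apply: lerD.
  by apply: le_trans (dot_le_dual _ _) _; rewrite ler_piMl ?dual_norm_ge0.
by apply: le_trans (dot_le_dual _ _) _; rewrite ler_piMl ?dual_norm_ge0.
Qed.

Lemma dual_normN u : dual_norm N (- u) = dual_norm N u.
Proof.
apply/eqP; rewrite eq_le; apply/andP; split; apply: dual_norm_le => z hz.
  rewrite dotNr -dotNl; apply: le_trans (dot_le_dual _ _) _.
  by rewrite is_normN ler_piMl ?dual_norm_ge0.
rewrite -[u in dot _ u]opprK dotNr -dotNl; apply: le_trans (dot_le_dual _ _) _.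
by rewrite is_normN ler_piMl ?dual_norm_ge0.
Qed.

Lemma dual_norm_upper : exists2 C : R, 0 < C & forall u, dual_norm N u <= C * `|u|.
Proof.
have [C C0 hC] := is_norm_lower.
exists (n%:R * C + 1); first by apply: ltr_wpDl => //; rewrite mulr_ge0 // ltW.
move=> u; apply: dual_norm_le => z hz.
apply: le_trans (ler_norm _) _; apply: le_trans (dot_le_norm _ _) _.
rewrite ler_wpM2r // -[leLHS]addr0 lerD // ler_wpM2l //.
by apply: le_trans (hC z) _; rewrite ger_pMr.
Qed.

(** Each coordinate is dominated by the dual norm. *)
Lemma coord_le_dual : exists2 C : R, 0 < C &
  forall u i, `|u 0 i| <= C * dual_norm N u.
Proof.
have [C C0 hC] := is_norm_upper.
exists C => // u i; rewrite ler_norml.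
have h v : dot (delta_mx 0 i) v <= C * dual_norm N v.
  apply: le_trans (dot_le_dual _ _) _; rewrite ler_wpM2r ?dual_norm_ge0 //.
  apply: le_trans (hC _) _; rewrite -[leRHS]mulr1 ler_pM2l //.
  rewrite [leLHS]/Num.norm /= mx_normrE; apply: bigmax_le => // -[a b] _ /=.
  by rewrite mxE; case: (_ && _); rewrite ?normr0 ?normr1.
have := h u; have := h (- u); rewrite !dot_delta dual_normN mxE => h1 h2.
by apply/andP; split; lra.
Qed.

End Norms.

(** * The prox mapping *)

Section Prox.
Context {R : realType} {n : nat} (N : 'rV[R]_n -> R) (X : set 'rV[R]_n).
Context (s : 'rV[R]_n -> R) (LV theta : R).
Hypothesis normN : is_norm N.
Hypothesis convX : convex_set X.
Hypothesis theta1 : 1 <= theta.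
Hypothesis V_lower : forall y z, X y -> X z ->
  theta / 2 * N (y - z) ^+ 2 <= Vdist s y z.
Hypothesis LV0 : 0 < LV.
Hypothesis grad_lip : forall y z, X y -> X z ->
  dual_norm N (grad s y - grad s z) <= LV * N (y - z).
Hypothesis V_upper : forall y z, X y -> X z ->
  Vdist s y z <= LV ^+ 2 * N (y - z) ^+ 2.
Implicit Types x y z r : 'rV[R]_n.

Lemma Vdist_ge y z : X y -> X z -> N (y - z) ^+ 2 <= 2 * Vdist s y z.
Proof.
move=> Xy Xz; have := V_lower Xy Xz; have := sqr_ge0 (N (y - z)).
move: theta1; set q := _ ^+ 2; nra.
Qed.

Lemma Vdist_ge0 y z : X y -> X z -> 0 <= Vdist s y z.
Proof. by move=> Xy Xz; have := Vdist_ge Xy Xz; have := sqr_ge0 (N (y - z)); lra. Qed.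

Lemma Vdist_three_point x y z :
  Vdist s x y - Vdist s z y - Vdist s x z = dot (grad s z - grad s x) (y - z).
Proof. by rewrite /Vdist !dotE; ring. Qed.

Lemma prox_sub x r z : prox X s x r z -> X z.
Proof. by case. Qed.

(** First-order optimality.  The quadratic upper bound on the Bregman distance
    plays the role of differentiability along the segment from z to y. *)
Lemma prox_variational x r y z : prox X s x r z -> X y ->
  0 <= dot (r + grad s z - grad s x) (y - z).
Proof.
move=> [Xz zmin] Xy; set A := dot _ _; rewrite leNgt; apply/negP => A0.
set q := LV ^+ 2 * N (y - z) ^+ 2.
have q0 : 0 <= q by rewrite mulr_ge0 ?sqr_ge0.
have key (t : R) : 0 < t -> t <= 1 -> 0 <= A + t * q.
  move=> t0 t1; pose zt := z + t *: (y - z).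
  have Xzt : X zt.
    have /set_mem := convX (Itv01 (ltW t0) t1) (mem_set Xy) (mem_set Xz).
    suff <- : t *: y + (1 - t) *: z = zt by [].
    by rewrite /zt scalerBr scalerBl scale1r addrCA.
  have := zmin _ Xzt; have := V_upper Xz Xzt.
  have -> : z - zt = - (t *: (y - z)) by rewrite /zt opprD addrA subrr add0r.
  rewrite is_normN // is_normZ // exprMn real_normK ?num_real //.
  rewrite /zt /Vdist !dotE -/q /A => h1 h2.
  suff : 0 <= t * (A + t * q) by rewrite pmulr_rge0.
  rewrite /A !dotE /q; nra.
(* For q > 0 the parameter t := min 1 (- A / (2 q)) makes A + t q negative. *)
have [q00|qn0] := eqVneq q 0.
  by have := key 1 ltr01 (lexx _); rewrite q00 mulr0 addr0 leNgt A0.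
have qp : 0 < q by rewrite lt_def qn0.
have := key (Num.min 1 (- A / 2 / q)).
have ap : 0 < - A / 2 / q by rewrite !divr_gt0 // oppr_gt0.
rewrite lt_min ltr01 ap ge_min lexx /= => /(_ isT isT).
have : Num.min 1 (- A / 2 / q) * q <= - A / 2.
  by rewrite -ler_pdivlMr // ge_min lexx orbT.
by move=> *; lra.
Qed.

Lemma prox_three_point x r y z : prox X s x r z -> X y ->
  Vdist s z y <= Vdist s x y - Vdist s x z + dot r (y - z).
Proof.
move=> pz Xy; have := prox_variational pz Xy.
by have := Vdist_three_point x y z; rewrite !dotE; lra.
Qed.

Lemma prox_lipschitz x x' r r' z z' : X x -> X x' ->
  prox X s x r z -> prox X s x' r' z' ->
  N (z - z') <= dual_norm N (r - r') + LV * N (x - x').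
Proof.
move=> Xx Xx' pz pz'.
have [Xz _] := pz; have [Xz' _] := pz'.
have h1 := prox_variational pz Xz'; have h2 := prox_variational pz' Xz.
have h3 := Vdist_ge Xz Xz'; have h4 := Vdist_ge Xz' Xz.
have h5 := dot_le_dual normN (z' - z) (r - r').
have h6 := dot_le_dual normN (z' - z) (grad s x' - grad s x).
have h7 := grad_lip Xx' Xx.
have N0 := is_norm_ge0 normN (z - z').
have D0 := dual_norm_ge0 normN (r - r').
have Nx0 := is_norm_ge0 normN (x - x').
move: h4 h5 h6 h7; rewrite !(is_normB normN z' z) !(is_normB normN x' x) => h4 h5 h6 h7.
have h8 : N (z - z') * dual_norm N (grad s x' - grad s x) <=
          N (z - z') * (LV * N (x - x')) by rewrite ler_wpM2l.
have h9 : N (z - z') ^+ 2 <= N (z - z') * (dual_norm N (r - r') + LV * N (x - x')).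
  have e : Vdist s z z' + Vdist s z' z = dot (grad s z' - grad s z) (z' - z).
    by rewrite /Vdist !dotE; ring.
  rewrite (dotC (z' - z) (r - r')) in h5.
  rewrite (dotC (z' - z)) in h6.
  rewrite -(opprB z' z) dotNr in h2; rewrite mulrDr.
  move: h1 h2 h3 h4 h5 h6 h8 e.
  move: (Vdist s z z') (Vdist s z' z) (N _ ^+ 2) (_ * dual_norm _ (r - r'))
    (_ * dual_norm _ (grad s x' - _)) (_ * (LV * _)) => v1 v2 n2 m1 m2 m3.
  move: (grad s z) (grad s z') (grad s x) (grad s x') (z' - z) => b1 b2 b3 b4 q.
  rewrite !(dotDl, dotNl).
  move: (dot r q) (dot r' q) (dot b1 q) (dot b2 q) (dot b3 q) (dot b4 q) => *; lra.
have [->|Nz] := eqVneq (N (z - z')) 0; first by rewrite addr_ge0 // mulr_ge0 // ltW.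
by rewrite -(@ler_pM2l _ (N (z - z'))) ?lt_def ?Nz.
Qed.

Lemma Vdist_lipschitz x x' y : X x -> X x' -> X y ->
  `|Vdist s x y - Vdist s x' y| <=
    N (x - x') * (LV ^+ 2 * N (x - x') + LV * N (x' - y)).
Proof.
move=> Xx Xx' Xy; have e := Vdist_three_point x y x'.
have h1 := V_upper Xx Xx'; have h2 := Vdist_ge0 Xx Xx'.
have h3 := dot_le_dual normN (y - x') (grad s x' - grad s x).
have h4 := dot_le_dual normN (x' - y) (grad s x' - grad s x).
have h5 := grad_lip Xx' Xx; rewrite (is_normB normN x' x) in h5.
rewrite (is_normB normN y x') in h3.
have h6 : N (x' - y) * dual_norm N (grad s x' - grad s x) <=
   N (x' - y) * (LV * N (x - x')) by rewrite ler_wpM2l ?(is_norm_ge0 normN).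
rewrite -(opprB x' y) dotNr dotC in e; rewrite -(opprB x' y) dotNl in h3.
have e2 : N (x - x') * (LV ^+ 2 * N (x - x') + LV * N (x' - y)) =
  LV ^+ 2 * N (x - x') ^+ 2 + N (x' - y) * (LV * N (x - x')) by ring.
rewrite e2 ler_norml; move: e h3 h4 h6 h1 h2; rewrite !expr2.
set d := dot _ _; set p := N (x' - y) * dual_norm _ _.
set q := N (x' - y) * (LV * _); set l := LV * LV * _.
by move=> *; apply/andP; split; lra.
Qed.

(** One mirror-prox step from a, through the midpoint b, to a'. *)
Lemma mirror_prox_step (F : 'rV[R]_n -> 'rV[R]_n) (B g : R) a b a' u v y :
  0 <= g -> X a -> X y ->
  (forall z, X z -> dual_norm N (F z) <= B / 2) ->
  prox X s a (g *: (F a + u)) b -> prox X s a (g *: (F b + v)) a' ->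
  Vdist s a' y <= Vdist s a y - g * dot (F b) (b - y) + g * dot v (y - a)
    - N (a - b) ^+ 2 / 4
    + 3 * (g ^+ 2 * (B ^+ 2 + dual_norm N u ^+ 2 + dual_norm N v ^+ 2)).
Proof.
move=> g0 Xa Xy FB pb pa'.
have Xb := prox_sub pb; have Xa' := prox_sub pa'.
have h1 := prox_three_point pa' Xy; have h2 := prox_three_point pb Xa'.
have D0 w : 0 <= dual_norm N w by exact: dual_norm_ge0.
have N0 w : 0 <= N w by exact: is_norm_ge0.
have FbB := FB _ Xb; have FaB := FB _ Xa.
(* the two gradient estimates differ by a term of second order *)
have h3 : g * dot (F b + v - (F a + u)) (b - a') <=
    g ^+ 2 * dual_norm N (F b + v - (F a + u)) ^+ 2 / 2 + Vdist s b a'.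
  have := dot_le_dual normN (b - a') (F b + v - (F a + u)); rewrite dotC.
  have := Vdist_ge Xb Xa'.
  set p := N (b - a'); set q := dual_norm N _; set d := dot _ _ => k1 k2.
  have : 0 <= (p - g * q) ^+ 2 by exact: sqr_ge0.
  have : g * d <= g * (p * q) by rewrite ler_wpM2l.
  by move: k1; rewrite !expr2; lra.
have h4 : dual_norm N (F b + v - (F a + u)) ^+ 2 <=
    3 * (B ^+ 2 + dual_norm N u ^+ 2 + dual_norm N v ^+ 2).
  have k1 : dual_norm N (F b + v - (F a + u)) <= B + dual_norm N u + dual_norm N v.
    have := dual_normD normN (F b + v) (- (F a + u)).
    have := dual_normD normN (F b) v; have := dual_normD normN (F a) u.
    by rewrite dual_normN //; lra.
  have : dual_norm N (F b + v - (F a + u)) ^+ 2 <= (B + dual_norm N u + dual_norm N v) ^+ 2.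
    by rewrite lerXn2r ?nnegrE ?(le_trans _ k1).
  set p := dual_norm N u; set q := dual_norm N v.
  have := sqr_ge0 (B - p); have := sqr_ge0 (B - q); have := sqr_ge0 (p - q).
  by rewrite !expr2; lra.
have h5 : g * dot v (a - b) <= g ^+ 2 * dual_norm N v ^+ 2 + N (a - b) ^+ 2 / 4.
  have := dot_le_dual normN (a - b) v; rewrite dotC.
  set p := N (a - b); set q := dual_norm N _; set d := dot _ _ => k2.
  have : 0 <= (p / 2 - g * q) ^+ 2 by exact: sqr_ge0.
  have : g * d <= g * (p * q) by rewrite ler_wpM2l.
  by rewrite !expr2; lra.
have h6 := Vdist_ge Xa Xb.
have gg : 0 <= g ^+ 2 by exact: sqr_ge0.
have h7 := ler_wpM2l gg h4.
have h8 : 0 <= g ^+ 2 * B ^+ 2 by rewrite mulr_ge0 ?sqr_ge0.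
have h9 : 0 <= g ^+ 2 * dual_norm N u ^+ 2 by rewrite mulr_ge0 ?sqr_ge0.
have h10 : 0 <= g ^+ 2 * dual_norm N v ^+ 2 by rewrite mulr_ge0 ?sqr_ge0.
move: h1 h2 h3 h5 h7; rewrite !dotE; lra.
Qed.

End Prox.

(** * Borel measurability of vector-valued maps *)

Section BorelRowVectors.
Context {R : realType} {d : measure_display} {S : measurableType d}.

Lemma rV_measurable_open n (Y : S -> borel_rV R n) :
  (forall U : set 'rV[R]_n, open U -> measurable (Y @^-1` U)) ->
  measurable_fun setT Y.
Proof.
move=> h; apply: (@measurability _ _ _ (borel_rV R n) _ _ (@open 'rV[R]_n) erefl).
move=> _ [U oU <-].
by rewrite setTI; exact: h.
Qed.

Lemma rV_measurable_preimage n (Y : S -> borel_rV R n) (U : set 'rV[R]_n) :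
  measurable_fun setT Y -> open U -> measurable (Y @^-1` U).
Proof.
move=> mY oU; rewrite -[_ @^-1` _]setTI; apply: mY => //.
exact: sub_sigma_algebra.
Qed.

Lemma rV_measurable_coord n (Y : S -> borel_rV R n) i :
  measurable_fun setT Y -> measurable_fun setT (fun t => (Y t : 'rV[R]_n) 0 i).
Proof.
move=> mY; apply: (measurability _ (RGenOInfty.measurableE R)) => // _ [_ [r ->] <-].
rewrite setTI.
suff oU : open [set v : 'rV[R]_n | r < v 0 i].
  have := rV_measurable_preimage mY oU; congr measurable.
  by apply/seteqP; split => t /=; rewrite in_itv /= andbT.
rewrite openE => v /= rv; apply/nbhs_ballP; exists (v 0 i - r); first by rewrite /= subr_gt0.
move=> u; rewrite -ball_normE /= => uv.
have := normr_coord (v - u) i; rewrite !mxE => h.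
have := ler_norm (v 0 i - u 0 i); lra.
Qed.

(** Coordinatewise measurability suffices: an open set is a countable union of
    boxes with rational centres. *)
Lemma rV_measurable n (Y : S -> borel_rV R n) :
  (forall i, measurable_fun setT (fun t => (Y t : 'rV[R]_n) 0 i)) ->
  measurable_fun setT Y.
Proof.
move=> mY; apply: rV_measurable_open => U oU.
pose box (p : 'rV[rat]_n * nat) : set 'rV[R]_n :=
  [set v | forall i, `|v 0 i - ratr (p.1 0 i)| < p.2.+1%:R^-1].
have mbox p : measurable (Y @^-1` box p).
  have -> : Y @^-1` box p =
      \bigcap_(i in [set: 'I_n])
        ((fun t => (Y t : 'rV[R]_n) 0 i) @^-1` ball (ratr (p.1 0 i) : R) p.2.+1%:R^-1).
    apply/seteqP; split => t /=.
      by move=> h i _ /=; rewrite -ball_normE /= distrC; exact: h.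
    by move=> h i; have := h i I; rewrite /= -ball_normE /= distrC.
  apply: fin_bigcap_measurable; first exact: finite_finset.
  move=> i _; rewrite -[_ @^-1` _]setTI; apply: mY => //.
  by apply: open_measurable; exact: ball_open.
have -> : Y @^-1` U = \bigcup_p (if `[< box p `<=` U >] then Y @^-1` box p else set0).
  apply/seteqP; split => t /=; last first.
    by case=> p _; case: asboolP => // h; exact: h.
  move=> Ut; have := oU; rewrite openE => /(_ _ Ut) /nbhs_ballP[e /= e0 he].
  have [k hk] : exists k : nat, k.+1%:R^-1 < e / 2.
    have e20 : 0 < e / 2 by rewrite divr_gt0.
    have [k _ hk] := near_infty_natSinv_lt (PosNum e20).
    by exists k; exact: (hk k (leqnn k)).
  set y : 'rV[R]_n := Y t.
  have hq i : exists q : rat, `|y 0 i - ratr q| < k.+1%:R^-1.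
    have k0 : 0 < k.+1%:R^-1 :> R by rewrite invr_gt0.
    have hlt : y 0 i - k.+1%:R^-1 < y 0 i + k.+1%:R^-1.
      by rewrite ltrD2l gtrN.
    have [q] := rat_in_itvoo hlt.
    rewrite in_itv /= => /andP[q1 q2]; exists q.
    by rewrite ltr_distlC q1 q2.
  have [q qP] := choice hq.
  have hb : box (\row_i q i, k) y by move=> i; rewrite /= mxE.
  exists (\row_i q i, k) => //; case: asboolP => // -[] v hv.
  apply: he; rewrite -ball_normE /=.
  apply: normr_row_lt => // i; rewrite !mxE.
  have := hv i; have := hb i; rewrite /= !mxE => h1 h2.
  apply: le_lt_trans (ler_distD (ratr (q i)) _ _) _.
  by rewrite (distrC (ratr _)) [e]splitr ltrD // (lt_trans _ hk).
apply: countable_bigcupT_measurable; first exact: countableP.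
by move=> p; case: asboolP.
Qed.

Lemma rV_measurable_row_mx m n (Y : S -> borel_rV R m) (Z : S -> borel_rV R n) :
  measurable_fun setT Y -> measurable_fun setT Z ->
  measurable_fun setT ((fun t => row_mx (Y t : 'rV[R]_m) (Z t : 'rV[R]_n)) : S -> borel_rV R (m + n)).
Proof.
move=> mY mZ; apply: rV_measurable => i.
under eq_fun do rewrite mxE.
by case: (fintype.split i) => j; exact: rV_measurable_coord.
Qed.

(** A map depending continuously on a measurable vector is measurable. *)
Lemma rV_measurable_factor m n (Y : S -> borel_rV R m) (Z : S -> borel_rV R n) :
  measurable_fun setT Y ->
  (forall t e, 0 < e -> exists2 delta, 0 < delta &
     forall t', `|(Y t - Y t' : 'rV[R]_m)| < delta -> `|(Z t - Z t' : 'rV[R]_n)| < e) ->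
  measurable_fun setT Z.
Proof.
move=> mY h; apply: rV_measurable_open => U oU.
pose O : set 'rV[R]_m := \bigcup_(p in [set p : S * R | 0 < p.2 /\
  forall t', `|(Y p.1 - Y t' : 'rV[R]_m)| < p.2 -> U (Z t')]) ball (Y p.1 : 'rV[R]_m) p.2.
have oO : open O by apply: bigcup_open => p [p0 _]; exact: ball_open.
suff -> : Z @^-1` U = Y @^-1` O by exact: rV_measurable_preimage.
apply/seteqP; split => t /=; last first.
  by case=> -[t0 r] /= [r0 ht]; rewrite -ball_normE /= => ?; exact: ht.
move=> Ut; have := oU; rewrite openE => /(_ _ Ut) /nbhs_ballP[e /= e0 he].
have [dl d0 hd] := h t e e0.
exists (t, dl) => /=; last exact: ballxx.
by split=> // t' tt'; apply: he; rewrite -ball_normE /=; exact: hd.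
Qed.

Lemma real_measurable_factor m (Y : S -> borel_rV R m) (Z : S -> R) :
  measurable_fun setT Y ->
  (forall t e, 0 < e -> exists2 delta, 0 < delta &
     forall t', `|(Y t - Y t' : 'rV[R]_m)| < delta -> `|Z t - Z t'| < e) ->
  measurable_fun setT Z.
Proof.
move=> mY h.
have : measurable_fun setT ((fun t => \row_(_ < 1) Z t) : S -> borel_rV R 1).
  apply: (rV_measurable_factor mY) => t e e0; have [dl d0 hd] := h t e e0.
  exists dl => // t' tt'; apply: normr_row_lt => // i; rewrite !mxE; exact: hd.
by move=> /(rV_measurable_coord ord0); apply: eq_measurable_fun => t _; rewrite mxE.
Qed.

End BorelRowVectors.

(** * Orthogonality to a sub-sigma-algebra *)

(** The function h is measurable for the sigma-algebra generated by G. *)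
Notation adapted G h :=
  (measurable_fun [set: g_sigma_algebraType G] (h : g_sigma_algebraType G -> _)).

Section Orthogonality.
Context {R : realType} {d : measure_display} {T : measurableType d}.
Variable P : probability T R.
Implicit Types (f h : T -> R) (G : set (set T)).

Local Notation Int f := (P.-integrable [set: T] (EFin \o f)).

Lemma adapted_sub d' (T' : measurableType d') G G' (h : T -> T') :
  G `<=` <<s G' >> -> adapted G h -> adapted G' h.
Proof.
move=> GG' mh _ B mB; have := mh measurableT B mB.
by rewrite /measurable /=; apply: smallest_sub.
Qed.

Lemma adapted_measurable d' (T' : measurableType d') G (h : T -> T') :
  G `<=` measurable -> adapted G h -> measurable_fun setT h.
Proof.
move=> GT mh _ B mB; have := mh measurableT B mB.
rewrite /measurable /=; apply: smallest_sub => //.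
exact: sigma_algebra_measurable.
Qed.

Lemma integrableM_bounded f h (M : R) : Int f -> measurable_fun setT h ->
  (forall t, `|h t| <= M) -> Int (fun t => f t * h t).
Proof.
move=> If mh hM; have := integrableMl measurableT If mh.
have bh : [bounded h x | x in setT].
  by exists M; split; [exact: num_real|move=> r Mr t _ /=; exact: le_trans (hM t) (ltW Mr)].
by move=> /(_ bh); apply: eq_integrable => // t _ /=; rewrite EFinM.
Qed.

Lemma Rintegral_setT_indic f A : measurable A ->
  \int[P]_(t in A) f t = \int[P]_t (f t * \1_A t).
Proof.
move=> mA; rewrite Rintegral_mkcond; apply: eq_Rintegral => t _.
rewrite patchE indicE; case: (t \in A); first by rewrite mulr1.
by rewrite mulr0.
Qed.

Lemma integrable_indicM f A : measurable A -> Int f -> Int (fun t => f t * \1_A t).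
Proof.
move=> mA If; apply: (@integrableM_bounded _ _ 1) => // t.
by rewrite indicE; case: (t \in A); rewrite ?normr1 ?normr0.
Qed.

Lemma sum_indic_approx (y : R) (K : nat) : 0 <= y -> y <= K%:R ->
  `|y - \sum_(i < K) (i.+1%:R <= y)%R%:R| <= 1.
Proof.
suff h : 0 <= y -> `|Num.min y K%:R - \sum_(i < K) (i.+1%:R <= y)%R%:R| <= 1.
  by move=> y0 yK; have := h y0; rewrite min_l.
move=> y0; elim: K => [|K]; first by rewrite big_ord0 subr0 min_r // normr0.
rewrite big_ord_recr /=.
have [yK|yK] := leP K.+1%:R y.
  have KK1 : K%:R <= K.+1%:R :> R by rewrite ler_nat.
  rewrite (min_r (le_trans KK1 yK)) /=.
  by rewrite -natr1 opprD addrACA subrr addr0.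
rewrite addr0 => ih.
have [yK'|yK'] := leP y K%:R; first by move: ih; rewrite min_l.
rewrite (eq_bigr (fun=> 1)); last first.
  move=> i _; suff -> : i.+1%:R <= y by [].
  by rewrite (le_trans _ (ltW yK')) // ler_nat.
rewrite sumr_const card_ord.
move: yK; rewrite -natr1 => yK; rewrite ler_norml; apply/andP; split; lra.
Qed.

(** A function whose integral vanishes over every set of a sigma-algebra is
    orthogonal to the bounded functions measurable for it.  Layer-cake: K h is
    within distance 1 of a sum of K indicators, so that K times the integral of
    f h stays bounded as K grows. *)
Lemma Rintegral_orthogonal01 G f h : sigma_algebra setT G -> G `<=` measurable ->
  Int f -> (forall A, G A -> \int[P]_(t in A) f t = 0) ->
  adapted G h -> (forall t, 0 <= h t <= 1) -> \int[P]_t (f t * h t) = 0.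
Proof.
move=> sG GT If f0 ah h01.
have mh := adapted_measurable GT ah.
have hb t : `|h t| <= 1 by have /andP[h0 h1] := h01 t; rewrite ger0_norm.
have Ifh := integrableM_bounded If mh hb.
have key (K : nat) : K%:R * `|\int[P]_t (f t * h t)| <= \int[P]_t `|f t|.
  pose A (i : nat) : set T := [set t | i.+1%:R <= K%:R * h t].
  have GA i : G (A i).
    have : adapted G (fun t => K%:R * h t) by exact: measurable_funM.
    move=> /(_ measurableT `[i.+1%:R, +oo[%classic (measurable_itv _)).
    rewrite /measurable /= (sigma_algebra_id sG) setTI; congr G.
    by apply/seteqP; split => t; rewrite /A /= in_itv /= andbT.
  have mA i := GT _ (GA i).
  have step j : Int (fun t => f t * \sum_(i < j) \1_(A i) t) /\
      \int[P]_t (f t * \sum_(i < j) \1_(A i) t) = 0.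
    elim: j => [|j [Ij ihj]].
      split; first by apply: eq_integrable (integrable0 P setT) => // t _ /=;
        rewrite big_ord0 mulr0.
      by under eq_Rintegral do rewrite big_ord0 mulr0; rewrite Rintegral_cst // mul0r.
    have Ia := integrable_indicM (mA j) If.
    split.
      apply: eq_integrable (integrableD measurableT Ij Ia) => // t _ /=.
      by rewrite big_ord_recr /= mulrDr EFinD.
    under eq_Rintegral do rewrite big_ord_recr /= mulrDr.
    by rewrite RintegralD // ihj add0r -Rintegral_setT_indic // f0.
  have [IS S0] := step K.
  have IK : Int (fun t => K%:R * (f t * h t)).
    by apply: eq_integrable (integrableZl measurableT K%:R Ifh) => // t _ /=.
  have -> : K%:R * `|\int[P]_t (f t * h t)| =
      `|\int[P]_t (K%:R * (f t * h t) - f t * \sum_(i < K) \1_(A i) t)|.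
    by rewrite RintegralB // S0 subr0 RintegralZl // normrM normr_nat.
  have ID : Int (fun t => K%:R * (f t * h t) - f t * \sum_(i < K) \1_(A i) t).
    by apply: eq_integrable (integrableB measurableT IK IS) => // t _ /=.
  apply: le_trans (le_normr_Rintegral measurableT ID) _.
  apply: le_Rintegral => //.
  - exact: integrable_norm.
  - exact: integrable_norm.
  move=> t _; rewrite mulrCA -mulrBr normrM ler_piMr //.
  have /andP[h0 h1] := h01 t.
  have -> : \sum_(i < K) \1_(A i) t = \sum_(i < K) (i.+1%:R <= K%:R * h t)%R%:R :> R.
    by apply: eq_bigr => i _; rewrite indicE /A; congr ((nat_of_bool _)%:R);
      apply/idP/idP => [/set_mem//|?]; exact/mem_set.
  by apply: sum_indic_approx; rewrite ?mulr_ge0 // ler_piMr.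
apply/eqP; rewrite -normr_eq0; apply: contraT => I0.
have Ip : 0 < `|\int[P]_t (f t * h t)| by rewrite lt_def I0 /=.
have := key (Num.truncn ((\int[P]_t `|f t|) / `|\int[P]_t (f t * h t)|)).+1.
by rewrite -ler_pdivlMr // leNgt truncnS_gt.
Qed.

Lemma Rintegral_orthogonal G f h (M : R) : sigma_algebra setT G -> G `<=` measurable ->
  Int f -> (forall A, G A -> \int[P]_(t in A) f t = 0) ->
  adapted G h -> (forall t, `|h t| <= M) -> \int[P]_t (f t * h t) = 0.
Proof.
move=> sG GT If f0 ah hM.
have fT : \int[P]_t f t = 0.
  by apply: f0; case: (sG) => s0 sC _; have := sC _ s0; rewrite setD0.
have [M0|M0] := leP M 0.
  have h0 t : h t = 0 by apply/eqP; rewrite -normr_le0 (le_trans (hM t)).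
  by under eq_Rintegral do rewrite h0 mulr0; rewrite Rintegral_cst // mul0r.
pose k t := (h t + M) / (2 * M).
have ak : adapted G k.
  by apply: measurable_funM => //; apply: measurable_funD.
have k01 t : 0 <= k t <= 1.
  have := hM t; rewrite ler_norml => /andP[h1 h2].
  by rewrite /k divr_ge0 ?ler_pdivrMr ?mul1r; lra.
have k0 := Rintegral_orthogonal01 sG GT If f0 ak k01.
have Ik : Int (fun t => f t * k t).
  apply: (@integrableM_bounded _ _ 1) => //; first exact: adapted_measurable ak.
  by move=> t; have /andP[a b] := k01 t; rewrite ger0_norm.
transitivity (\int[P]_t (2 * M * (f t * k t) - M * f t)).
  by apply: eq_Rintegral => t _; rewrite /k; field; rewrite gt_eqF.
rewrite RintegralB //.
- by rewrite !RintegralZl // k0 fT !mulr0 subr0.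
- by apply: eq_integrable (integrableZl measurableT (2 * M) Ik) => // t _.
- by apply: eq_integrable (integrableZl measurableT M If) => // t _.
Qed.

End Orthogonality.

(** * Convergence of martingale series with summable variances *)

(** The partial sums of D from index m on, frozen as soon as they leave the
    open interval of radius eps. *)
Fixpoint stopped_sum {R : realType} {T : Type} (D : nat -> T -> R) (m : nat)
    (eps : R) (j : nat) (t : T) : R :=
  if j is j'.+1 then
    if `|stopped_sum D m eps j' t| < eps
    then stopped_sum D m eps j' t + D (m + j')%N t
    else stopped_sum D m eps j' t
  else 0.

Section MartingaleSeries.
Context {R : realType} {d : measure_display} {T : measurableType d}.
Variables (P : probability T R) (G : nat -> set (set T)).
Variables (D : nat -> T -> R) (v : nat -> R).

Local Notation Int f := (P.-integrable [set: T] (EFin \o f)).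

Hypothesis GT : forall k, G k `<=` measurable.
Hypothesis GS : forall k, G k `<=` G k.+1.
Hypothesis ID : forall k, Int (D k).
Hypothesis D_orth : forall k (h : T -> R) (M : R), adapted (G k) h -> (forall t, `|h t| <= M) ->
  \int[P]_t (D k t * h t) = 0.
Hypothesis aD : forall k, adapted (G k.+1) (D k).
Hypothesis ID2 : forall k, Int (fun t => D k t ^+ 2).
Hypothesis vD : forall k, \int[P]_t (D k t ^+ 2) <= v k.
Hypothesis cv : cvgn (series v).

Let v0 k : 0 <= v k.
Proof. by apply: le_trans (vD k); apply: Rintegral_ge0 => t _; exact: sqr_ge0. Qed.

Lemma stopped_sum_adapted m eps j :
  adapted (G (m + j)) (stopped_sum D m eps j).
Proof.
elim: j => [|j ih]; first exact: measurable_cst.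
rewrite addnS; have ih' : adapted (G (m + j).+1) (stopped_sum D m eps j).
  by apply: adapted_sub ih => A /GS /sub_sigma_algebra; exact.
apply: measurable_fun_ifT => //.
- by apply: measurable_fun_ltr => //; exact: measurableT_comp.
- exact: measurable_funD.
Qed.

(** The increments are orthogonal to the past, so variances add up. *)
Lemma stopped_sum_moment m eps j :
  Int (fun t => stopped_sum D m eps j t ^+ 2) /\
  \int[P]_t (stopped_sum D m eps j t ^+ 2) <= \sum_(i < j) v (m + i).
Proof.
elim: j => [|j [Ij ihj]].
  split; last by under eq_Rintegral do rewrite /= expr0n; rewrite Rintegral_cst // mul0r big_ord0.
  by apply: eq_integrable (integrable0 P setT) => // t _; rewrite /= expr0n.
set U := stopped_sum D m eps j in Ij ihj *.
set k := (m + j)%N.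
have aU : adapted (G k) U by exact: stopped_sum_adapted.
have mb : adapted (G k) (fun t => `|U t| < eps).
  by apply: measurable_fun_ltr => //; exact: measurableT_comp.
pose chi t := if `|U t| < eps then U t else 0.
pose b t : R := if `|U t| < eps then 1 else 0.
have achi : adapted (G k) chi by exact: measurable_fun_ifT.
have ab : adapted (G k) b by exact: measurable_fun_ifT.
have chiM t : `|chi t| <= `|eps|.
  rewrite /chi; case: ifP => [/ltW h|_]; last by rewrite normr0.
  by rewrite (le_trans h) // ler_norm.
have b1 t : `|b t| <= 1 by rewrite /b; case: ifP; rewrite ?normr1 ?normr0.
have I1 := integrableM_bounded (ID k) (adapted_measurable (@GT k) achi) chiM.
have I2 := integrableM_bounded (ID2 k) (adapted_measurable (@GT k) ab) b1.
have I1' : Int (fun t => 2 * (D k t * chi t)).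
  by apply: eq_integrable (integrableZl measurableT 2 I1) => // t _.
have I3 : Int (fun t => U t ^+ 2 + 2 * (D k t * chi t)).
  by apply: eq_integrable (integrableD measurableT Ij I1') => // t _.
have E t : stopped_sum D m eps j.+1 t ^+ 2 =
    U t ^+ 2 + 2 * (D k t * chi t) + D k t ^+ 2 * b t.
  by rewrite /= -/U -/k /chi /b; case: ifP => _; ring.
split.
  apply: eq_integrable (integrableD measurableT I3 I2) => // t _ /=.
  by rewrite -EFinD -E.
under eq_Rintegral do rewrite E.
rewrite RintegralD // RintegralD // RintegralZl //.
rewrite (D_orth achi chiM) mulr0 addr0 big_ord_recr /=; apply: lerD => //.
apply: le_trans (vD k); apply: le_Rintegral => // t _.
by rewrite ler_piMr ?sqr_ge0 // (le_trans (ler_norm _)).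
Qed.

Let tail m : R := limn (series v) - series v m.

Let tail_ge m j : \sum_(i < j) v (m + i) <= tail m.
Proof.
have -> : \sum_(i < j) v (m + i)%N = series v (m + j)%N - series v m.
  elim: j => [|j ih]; first by rewrite big_ord0 addn0 subrr.
  by rewrite big_ord_recr /= ih addnS seriesSr addrAC.
rewrite lerD2r; apply: nondecreasing_cvgn_le => //.
by apply: nondecreasing_series => i _ _; exact: v0.
Qed.

Let tail_small e : 0 < e -> exists m, tail m < e.
Proof.
move=> e0; have /cvgrPdist_lt /(_ e e0) [m _ hm] := cv.
by exists m; have := hm m (leqnn m); apply: le_lt_trans; exact: ler_norm.
Qed.

Let exit m eps : set T := \bigcup_j [set t | eps <= `|stopped_sum D m eps j t|].

Let measurable_exit_at m eps j : measurable [set t | eps <= `|stopped_sum D m eps j t|].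
Proof.
have mU : measurable_fun setT (stopped_sum D m eps j).
  by apply: (adapted_measurable (@GT (m + j)%N)); exact: stopped_sum_adapted.
have : measurable_fun setT (fun t => `|stopped_sum D m eps j t|) by exact: measurableT_comp.
move=> /(_ measurableT `[eps, +oo[%classic (measurable_itv _)); congr measurable.
by rewrite setTI; apply/seteqP; split => t; rewrite /= in_itv /= andbT.
Qed.

Let measurable_exit m eps : measurable (exit m eps).
Proof. by apply: bigcupT_measurable => j; exact: measurable_exit_at. Qed.

(** Kolmogorov's maximal inequality: the second moment of the stopped sum bounds
    the probability of ever leaving the interval. *)
Let prob_exit m (eps : R) : 0 < eps -> (P (exit m eps) <= (tail m / eps ^+ 2)%:E)%E.
Proof.
move=> e0; have e20 : 0 < eps ^+ 2 by exact: exprn_gt0.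
have h j : (P [set t | (eps <= `|stopped_sum D m eps j t|)%R] <= (tail m / eps ^+ 2)%:E)%E.
  have [I2 M2] := stopped_sum_moment m eps j.
  pose f t := stopped_sum D m eps j t ^+ 2.
  have m2 : measurable_fun setT (EFin \o f) by exact: (measurable_int P).
  have := le_integral_abse P measurableT m2 e20.
  have -> : [set: T] `&` [set x | ((eps ^+ 2)%:E <= `|(EFin \o f) x|)%E] =
      [set t | eps <= `|stopped_sum D m eps j t|].
    rewrite setTI; apply/seteqP; split => t /=;
    by rewrite lee_fin normrX ler_sqr ?nnegrE // ltW.
  have -> : (\int[P]_(x in [set: T]) `|(EFin \o f) x| = (\int[P]_t (f t)%R)%:E)%E.
    rewrite /Rintegral fineK; last exact: integrable_fin_num.
    by apply: eq_integral => t _ /=; rewrite ger0_norm ?sqr_ge0.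
  rewrite -lee_pdivlMl // => /le_trans; apply.
  rewrite -EFinM lee_fin mulrC ler_pM2r ?invr_gt0 //.
  exact: le_trans M2 (tail_ge _ _).
have nd : {homo (fun j => [set t | eps <= `|stopped_sum D m eps j t|]) :
    n k / (n <= k)%N >-> (n <= k)%O}.
  move=> i k /subnKC <-; elim: (k - i)%N => [|l ih]; first by rewrite addn0.
  rewrite addnS; apply: le_trans ih _; apply/subsetPset => t /= ht.
  by rewrite ltNge ht.
have := nondecreasing_cvg_mu (mu := P) (measurable_exit_at m eps) (@measurable_exit m eps) nd.
move=> cP; rewrite -/(exit m eps) -(cvg_lim _ cP) //.
by apply: lime_le; [apply/cvg_ex; eexists; exact: cP|exact: nearW].
Qed.

Let stopped_sumE m eps j t :
  (forall i, (i < j)%N -> `|stopped_sum D m eps i t| < eps) ->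
  stopped_sum D m eps j t = series (D ^~ t) (m + j)%N - series (D ^~ t) m.
Proof.
elim: j => [|j ih] h /=; first by rewrite addn0 subrr.
rewrite (h j (ltnSn j)) ih => [|i ij]; last by apply: h; exact: ltnW.
by rewrite addnS seriesSr addrAC.
Qed.

Theorem martingale_series_cvg : {ae P, forall t, cvgn (series (D ^~ t))}.
Proof.
have hq (q : nat) : {ae P, forall t, exists m, forall j,
    `|series (D ^~ t) (m + j)%N - series (D ^~ t) m| < q.+1%:R^-1}.
  have q0 : 0 < q.+1%:R^-1 :> R by rewrite invr_gt0.
  set eps := q.+1%:R^-1 in q0 *.
  exists (\bigcap_m exit m eps); split.
  - by apply: bigcapT_measurable => m; exact: measurable_exit.
  - apply/eqP; rewrite eq_le measure_ge0 andbT; apply/lee_addgt0Pr => e e0.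
    rewrite add0e; have e20 : 0 < e * eps ^+ 2 by rewrite mulr_gt0 // exprn_gt0.
    have [m hm] := tail_small e20.
    apply: (@le_trans _ _ (P (exit m eps))).
      apply: le_measure; rewrite ?inE //.
        by apply: bigcapT_measurable => i; exact: measurable_exit.
      by move=> t; apply.
    apply: le_trans (prob_exit m q0) _.
    by rewrite lee_fin ler_pdivrMr ?exprn_gt0 // ltW.
  - move=> t /= nt m _; apply: contrapT => nexit; apply: nt; exists m => j.
    have h i : `|stopped_sum D m eps i t| < eps.
      by rewrite ltNge; apply/negP => hi; apply: nexit; exists i.
    by rewrite -(stopped_sumE (eps := eps)).
have := ae_foralln hq; apply: filterS => t ht.
apply: cauchy_cvg; apply: cauchy_exP => e e0.
have [q _ hqe] := near_infty_natSinv_lt (PosNum e0).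
have [m hm] := ht q.
exists (series (D ^~ t) m); exists m => // k /= mk.
rewrite -ball_normE /= distrC -(subnKC mk).
by apply: lt_trans (hm _) _; exact: (hqe q (leqnn q)).
Qed.

End MartingaleSeries.

(** * Real recursions *)

Section RealRecursions.
Context {R : realType}.
Implicit Types (a b c e p u v : nat -> R).

Lemma cvgn_normr_bounded a : cvgn a -> exists M : R, forall k, `|a k| <= M.
Proof.
move=> /cvg_seq_bounded [M [_ h]]; exists (M + 1) => k.
by apply: (h (M + 1)); rewrite ?ltrDl.
Qed.

Lemma cvg_series_sum (I : Type) (r : seq I) (f : I -> nat -> R) :
  (forall i, cvgn (series (f i))) -> cvgn (series (fun k => \sum_(i <- r) f i k)).
Proof.
move=> h; elim: r => [|i r ih].
  rewrite (_ : series _ = fun=> 0); first exact: is_cvg_cst.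
  apply/funext => n; rewrite /series /=; apply: big1 => k _; exact: big_nil.
rewrite (_ : series _ = series (f i) + series (fun k => \sum_(i <- r) f i k)).
  exact: is_cvgD.
apply/funext => n; rewrite /series /= -[RHS]big_split /=.
by apply: eq_bigr => k _; rewrite big_cons.
Qed.

Lemma cvg_seriesD a b : cvgn (series a) -> cvgn (series b) ->
  cvgn (series (fun k => a k + b k)).
Proof.
move=> ca cb; rewrite (_ : series _ = series a + series b); first exact: is_cvgD.
by apply/funext => n; rewrite /series /= -[RHS]big_split.
Qed.

Lemma cvg_seriesZ (l : R) a : cvgn (series a) -> cvgn (series (fun k => l * a k)).
Proof.
move=> ca; rewrite (_ : series _ = fun n => l * series a n); first exact: is_cvgMr.
by apply/funext => n; rewrite /series /= mulr_sumr.
Qed.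

Lemma nonneg_series_cvg p (M : R) : (forall k, 0 <= p k) ->
  (forall n, series p n <= M) -> cvgn (series p).
Proof.
move=> p0 h; apply: nondecreasing_is_cvgn.
  by apply: nondecreasing_series => k _ _; exact: p0.
by exists M => _ [n _ <-]; exact: h.
Qed.

(** A nonnegative sequence with convergent perturbations converges, and the
    decrements are summable. *)
Lemma perturbed_decreasing u c p : (forall k, 0 <= u k) -> (forall k, 0 <= p k) ->
  (forall k, u k.+1 <= u k + c k - p k) -> cvgn (series c) ->
  cvgn u /\ cvgn (series p).
Proof.
move=> u0 p0 h cc; have [M hM] := cvgn_normr_bounded cc.
have hs n : series p n <= u 0%N + series c n - u n.
  elim: n => [|n ih]; first by rewrite /series /= !big_geq //; lra.
  by rewrite !seriesSr; have := h n; lra.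
have cp : cvgn (series p).
  apply: (@nonneg_series_cvg _ (u 0%N + M)) => // n.
  have := hs n; have := hM n; have := ler_norm (series c n); have := u0 n; lra.
split => //.
pose w n := u n - series c n + series p n.
have cw : cvgn w.
  apply: nonincreasing_is_cvgn.
    apply: (@homo_leq _ _ (fun x y => y <= x)) => [|y x z xy yz|n]; first exact: lexx.
      exact: le_trans yz xy.
    by rewrite /w !seriesSr; have := h n; lra.
  exists (- M) => _ [n _ <-]; rewrite /w.
  have := u0 n; have := hM n; have := ler_norm (series c n).
  have : 0 <= series p n by rewrite /series /=; apply: sumr_ge0.
  lra.
rewrite (_ : u = w + series c - series p).
  by apply: is_cvgB => //; exact: is_cvgD.
by apply/funext => n; rewrite /w /= !fctE; ring.
Qed.

(** Gronwall's lemma for relative perturbations whose series converges, possibly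
    only conditionally. *)
Lemma relative_perturbation_bounded v dl e : (forall k, 1 <= v k) ->
  (forall k, 0 <= e k) -> (forall k, v k.+1 <= v k + v k * dl k + e k) ->
  cvgn (series dl) -> cvgn (series e) -> exists M : R, forall k, v k <= M.
Proof.
move=> v1 e0 h cd ce; have [M hM] := cvgn_normr_bounded (cvg_seriesD cd ce).
exists (v 0%N * expR M) => k.
have v0 j : 0 <= v j by exact: le_trans (v1 j).
apply: (@le_trans _ _ (v 0%N * expR (series (fun k => dl k + e k) k))).
  elim: k => [|k ih]; first by rewrite /series /= big_geq // expR0 mulr1.
  rewrite seriesSr expRD mulrA.
  apply: (@le_trans _ _ (v k * expR (dl k + e k))); last by rewrite ler_wpM2r ?expR_ge0.
  apply: (@le_trans _ _ (v k * (1 + (dl k + e k)))); last first.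
    by rewrite ler_wpM2l // expR_ge1Dx.
  have : e k <= v k * e k by rewrite ler_peMl.
  by have := h k; lra.
by rewrite ler_wpM2l // ler_expR (le_trans (ler_norm _)).
Qed.

(** If the steps are not summable, the values weighted by them are frequently
    small. *)
Lemma weighted_frequently_small a l p : (forall k, 0 < a k) -> ~ cvgn (series a) ->
  (forall k, a k * l k <= p k) -> (forall k, 0 <= p k) -> cvgn (series p) ->
  forall (e : R) (K : nat), 0 < e -> exists k, (K <= k)%N /\ l k < e.
Proof.
move=> a0 ca hp p0 cp e K e0; apply: contrapT => hn; apply: ca.
have hl k : (K <= k)%N -> e <= l k.
  by move=> Kk; rewrite leNgt; apply/negP => hk; apply: hn; exists k.
have [M hM] := cvgn_normr_bounded cp.
apply: (@nonneg_series_cvg _ (series a K + M / e)) => [k|n]; first exact: ltW.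
have M0 : 0 <= M by exact: le_trans (normr_ge0 _) (hM 0%N).
have mono : {homo series a : n m / (n <= m)%N >-> n <= m}.
  by apply: nondecreasing_series => k _ _; exact: ltW.
have [nK|Kn] := leqP n K.
  by apply: le_trans (mono _ _ nK) _; rewrite lerDl divr_ge0 // ltW.
have step j : series a (K + j)%N <= series a K + series p (K + j)%N / e.
  elim: j => [|j ih].
    by rewrite addn0 lerDl; apply: divr_ge0; [exact: sumr_ge0|exact: ltW].
  rewrite addnS !seriesSr mulrDl.
  have : a (K + j)%N <= p (K + j)%N / e.
    rewrite ler_pdivlMr //; apply: le_trans (hp _).
    by rewrite ler_pM2l // hl // leq_addr.
  lra.
rewrite -(subnKC (ltnW Kn)); apply: le_trans (step _) _.
by rewrite lerD2l ler_pM2r ?invr_gt0 // (le_trans (ler_norm _)).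
Qed.

End RealRecursions.

(** * Convergence along one trajectory *)

(** Truncation of a real number to the interval [-m, m]. *)
Definition clamp {R : realType} (m : nat) (a : R) : R := Num.max (- m%:R) (Num.min m%:R a).

Lemma clampE {R : realType} (m : nat) (a : R) : `|a| <= m%:R -> clamp m a = a.
Proof.
rewrite ler_norml => /andP[h1 h2]; rewrite /clamp.
by rewrite min_r // max_r.
Qed.

Lemma clamp_bound {R : realType} (m : nat) (a : R) : `|clamp m a| <= m%:R.
Proof.
rewrite ler_norml /clamp le_max lexx /= ge_max ge_min lexx /= andbT.
by rewrite (@le_trans _ _ 0) // oppr_le0.
Qed.

Lemma clamp_lipschitz {R : realType} (m : nat) (a b : R) : `|clamp m a - clamp m b| <= `|a - b|.
Proof.
have h (x y : R) : x <= y -> 0 <= clamp m y - clamp m x <= y - x.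
  move=> xy; rewrite /clamp.
  have : 0 <= m%:R :> R by []; move: (m%:R : R) => M M0.
  have E z : Num.max (- M) (Num.min M z) =
      if M <= z then M else if z <= - M then - M else z.
    have [Mz|zM] := leP M z; first by rewrite max_r //; lra.
    by case: (leP z (- M)).
  rewrite !E; case: (leP M x) => h1; case: (leP M y) => h2;
    case: (leP x (- M)) => h3; case: (leP y (- M)) => h4; apply/andP; split; lra.
have [ab|ba] := leP a b.
  by have /andP[h1 h2] := h _ _ ab; rewrite distrC (distrC a) !ger0_norm // subr_ge0.
by have /andP[h1 h2] := h _ _ (ltW ba); rewrite !ger0_norm // subr_ge0 ltW.
Qed.

Section Trajectory.
Context {R : realType} {n : nat} (N : 'rV[R]_n -> R) (X : set 'rV[R]_n).
Context (s : 'rV[R]_n -> R) (LV theta : R) (F : 'rV[R]_n -> 'rV[R]_n) (Ls B : R).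
Hypothesis normN : is_norm N.
Hypothesis closedX : closed X.
Hypothesis convX : convex_set X.
Hypothesis theta1 : 1 <= theta.
Hypothesis V_lower : forall y z, X y -> X z ->
  theta / 2 * N (y - z) ^+ 2 <= Vdist s y z.
Hypothesis LV0 : 0 < LV.
Hypothesis grad_lip : forall y z, X y -> X z ->
  dual_norm N (grad s y - grad s z) <= LV * N (y - z).
Hypothesis V_upper : forall y z, X y -> X z ->
  Vdist s y z <= LV ^+ 2 * N (y - z) ^+ 2.
Hypothesis Ls0 : 0 < Ls.
Hypothesis B0 : 0 < B.
Hypothesis F_lip : forall y z, X y -> X z -> dual_norm N (F y - F z) <= Ls * N (y - z).
Hypothesis F_bnd : forall y, X y -> dual_norm N (F y) <= B / 2.
Hypothesis F_pm : pseudomonotone_plus X F.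

Lemma SVI_dual_ge0 y z : SVI X F y -> X z -> 0 <= dot (F z) (z - y).
Proof.
move=> [Xy hy] Xz; rewrite dotC.
by have [[_ pm] _] := F_pm; apply: pm => //; exact: hy.
Qed.

(** Pseudomonotonicity-plus turns a zero of the gap function at a solution into
    another solution. *)
Lemma SVI_of_gap0 y z : SVI X F y -> X z -> dot (F z) (z - y) = 0 -> SVI X F z.
Proof.
move=> [Xy hy] Xz; rewrite dotC => gap0.
have Fzy : F z = F y by have [_ pp] := F_pm; apply: pp => //; exact: hy.
split => // x Xx; have := hy x Xx.
rewrite -Fzy in hy *; move: gap0; rewrite !dotE; lra.
Qed.

Lemma gap_continuous y z b : X z -> X b ->
  dot (F z) (z - y) <= dot (F b) (b - y) +
    N (z - b) * (B / 2 + Ls * (N (z - b) + N (z - y))).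
Proof.
move=> Xz Xb.
have -> : dot (F z) (z - y) = dot (F b) (b - y) + dot (z - b) (F z) + dot (b - y) (F z - F b).
  by rewrite !(dotC (z - b)) !(dotC (b - y)) !dotE; ring.
have h1 := dot_le_dual normN (z - b) (F z).
have h2 := dot_le_dual normN (b - y) (F z - F b).
have h3 : N (b - y) <= N (z - b) + N (z - y).
  have -> : b - y = - (z - b) + (z - y) by rewrite opprB addrA subrK.
  by apply: le_trans (is_normD normN _ _) _; rewrite is_normN.
have Nz w : 0 <= N w by exact: is_norm_ge0.
have h4 : N (z - b) * dual_norm N (F z) <= N (z - b) * (B / 2).
  by rewrite ler_wpM2l // F_bnd.
have h5 : N (b - y) * dual_norm N (F z - F b) <= (N (z - b) + N (z - y)) * (Ls * N (z - b)).
  by apply: ler_pM => //; [exact: dual_norm_ge0|exact: F_lip].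
have -> : N (z - b) * (B / 2 + Ls * (N (z - b) + N (z - y))) =
  N (z - b) * (B / 2) + (N (z - b) + N (z - y)) * (Ls * N (z - b)) by ring.
rewrite -!addrA; apply: lerD => //.
by apply: lerD; [exact: le_trans h1 h4|exact: le_trans h2 h5].
Qed.

Lemma cluster_frequently (y : nat -> 'rV[R]_n) z : cluster (y @ \oo) z ->
  forall (e : R) (K : nat), 0 < e -> exists k, (K <= k)%N /\ N (y k - z) < e.
Proof.
move=> cz e K e0; have [C C0 hC] := is_norm_upper normN.
have hA : (y @ \oo) [set y k | k in [set k | (K <= k)%N]].
  by exists K => // k Kk; exists k.
have hB : nbhs z (ball z (e / C)) by apply: nbhsx_ballx; rewrite divr_gt0.
have [_ [[k Kk <-]]] := cz _ _ hA hB.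
rewrite -ball_normE /= distrC => hk; exists k; split => //.
by apply: le_lt_trans (hC _) _; rewrite mulrC -ltr_pdivlMr.
Qed.

Context (gamma : nat -> R) (x xh u v : nat -> 'rV[R]_n) (y0 : 'rV[R]_n).
Hypothesis gamma0 : forall k, 0 < gamma k.
Hypothesis gammaoo : ~ cvgn (series gamma).
Hypothesis Xx0 : X (x 0%N).
Hypothesis scheme : forall k,
  prox X s (x k) (gamma k *: (F (x k) + u k)) (xh k) /\
  prox X s (x k) (gamma k *: (F (xh k) + v k)) (x k.+1).
Hypothesis Sy0 : SVI X F y0.

(** The second-order error of a step. *)
Let err k := 3 * (gamma k ^+ 2 *
  (B ^+ 2 + dual_norm N (u k) ^+ 2 + dual_norm N (v k) ^+ 2)).

Hypothesis err_cvg : cvgn (series err).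
Hypothesis noise_cvg : forall i, cvgn (series (fun k => gamma k * 1 * v k 0 i)).
Hypothesis clamp_cvg : forall m i,
  cvgn (series (fun k => gamma k * clamp m (x k 0 i) * v k 0 i)).
Hypothesis relative_cvg : forall i,
  cvgn (series (fun k => gamma k * ((y0 0 i - x k 0 i) / (1 + Vdist s (x k) y0)) * v k 0 i)).

Lemma scheme_in k : X (x k) /\ X (xh k).
Proof.
have Xx : X (x k) by case: k => // k; have [_ /prox_sub] := scheme k.
by split => //; have [/prox_sub] := scheme k.
Qed.

Let err0 k : 0 <= err k.
Proof.
apply: mulr_ge0 => //; apply: mulr_ge0; first exact: sqr_ge0.
by rewrite !addr_ge0 ?sqr_ge0.
Qed.

(** What a step gains towards a solution y. *)
Let gap y k := gamma k * dot (F (xh k)) (xh k - y) + N (x k - xh k) ^+ 2 / 4.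

Let gap_ge0 y k : SVI X F y -> 0 <= gap y k.
Proof.
move=> Sy; rewrite addr_ge0 ?divr_ge0 ?sqr_ge0 // mulr_ge0 ?(ltW (gamma0 k)) //.
by apply: SVI_dual_ge0 => //; have [] := scheme_in k.
Qed.

Let step y k : SVI X F y -> Vdist s (x k.+1) y <=
  Vdist s (x k) y + (gamma k * dot (v k) (y - x k) + err k) - gap y k.
Proof.
move=> [Xy _]; have [Xx _] := scheme_in k; have [s1 s2] := scheme k.
have := mirror_prox_step normN convX theta1 V_lower V_upper (ltW (gamma0 k)) Xx Xy F_bnd s1 s2.
by rewrite /gap /err; lra.
Qed.

Let Vge0 y k : X y -> 0 <= Vdist s (x k) y.
Proof. by move=> Xy; apply: (Vdist_ge0 theta1 V_lower) => //; have [] := scheme_in k. Qed.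

(** Dividing the noise by 1 + V makes the recursion multiplicative. *)
Lemma trajectory_bounded : exists M : R, forall k, N (x k) <= M.
Proof.
have [Xy0 _] := Sy0.
pose dl k := \sum_(i < n) gamma k * ((y0 0 i - x k 0 i) / (1 + Vdist s (x k) y0)) * v k 0 i.
have cdl : cvgn (series dl) by apply: cvg_series_sum.
have h k : 1 + Vdist s (x k.+1) y0 <=
    1 + Vdist s (x k) y0 + (1 + Vdist s (x k) y0) * dl k + err k.
  have := step k Sy0; have := gap_ge0 k Sy0.
  have -> : (1 + Vdist s (x k) y0) * dl k = gamma k * dot (v k) (y0 - x k).
    have V1 : 1 + Vdist s (x k) y0 != 0 by rewrite gt_eqF // ltr_pwDl // Vge0.
    rewrite /dl /dot !mulr_sumr; apply: eq_bigr => i _; rewrite !mxE.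
    by field.
  by lra.
have [|M hM] := relative_perturbation_bounded _ err0 h cdl err_cvg.
  by move=> k; rewrite lerDl Vge0.
exists (M + M + N y0) => k.
have [Xx _] := scheme_in k.
have h1 := Vdist_ge theta1 V_lower Xx Xy0; have h2 := hM k.
have h3 : N (x k) <= N (x k - y0) + N y0 by rewrite -{1}(subrK y0 (x k)); exact: is_normD.
have := sqr_ge0 (N (x k - y0) - 1); have := Vge0 k Xy0.
by move: h1; rewrite !expr2; lra.
Qed.

(** A bounded trajectory is not affected by a truncation at a high enough level. *)
Let martingale_cvg y : cvgn (series (fun k => gamma k * dot (v k) (y - x k))).
Proof.
have [M hM] := trajectory_bounded; have [C C0 hC] := is_norm_lower normN.
pose m := (Num.truncn (C * M)).+1.
have clampx k i : clamp m (x k 0 i) = x k 0 i.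
  apply: clampE; apply: le_trans (normr_coord _ _) _; apply: le_trans (hC _) _.
  apply: (@le_trans _ _ (C * M)); first by rewrite ler_pM2l.
  exact/ltW/truncnS_gt.
have -> : (fun k => gamma k * dot (v k) (y - x k)) = fun k =>
    \sum_(i < n) (y 0 i * (gamma k * 1 * v k 0 i) +
                 (-1) * (gamma k * clamp m (x k 0 i) * v k 0 i)).
  apply/funext => k; rewrite /dot mulr_sumr; apply: eq_bigr => i _.
  by rewrite clampx !mxE; ring.
apply: cvg_series_sum => i; apply: cvg_seriesD; exact: cvg_seriesZ.
Qed.

Let V_cvg y : SVI X F y -> cvgn (fun k => Vdist s (x k) y) /\ cvgn (series (gap y)).
Proof.
move=> Sy; apply: (perturbed_decreasing _ _ (fun k => step k Sy)).
- by move=> k; apply: Vge0; case: Sy.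
- by move=> k; exact: gap_ge0.
- exact: cvg_seriesD.
Qed.

Let midpoint_close e : 0 < e -> exists K, forall k, (K <= k)%N -> N (x k - xh k) < e.
Proof.
move=> e0; have [_ /cvg_series_cvg_0/cvgrPdist_lt hc] := V_cvg Sy0.
have e4 : 0 < e ^+ 2 / 4 by rewrite divr_gt0 // exprn_gt0.
have [K _ hK] := hc _ e4; exists K => k Kk; have := hK k Kk.
rewrite /= sub0r normrN => h.
have h1 : 0 <= gamma k * dot (F (xh k)) (xh k - y0).
  by rewrite mulr_ge0 ?(ltW (gamma0 k)) // SVI_dual_ge0 //; have [] := scheme_in k.
rewrite -(@ltr_pXn2r _ 2) ?nnegrE ?(is_norm_ge0 normN) ?ltW //.
by have := le_lt_trans (ler_norm _) h; rewrite /gap; lra.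
Qed.

(** Some cluster point of the trajectory is a solution. *)
Let solution_cluster : exists2 z, SVI X F z &
  forall (e : R) (K : nat), 0 < e -> exists k, (K <= k)%N /\ N (x k - z) < e.
Proof.
have [Xy0 _] := Sy0.
have [M hM] := trajectory_bounded; have [C C0 hC] := is_norm_lower normN.
have cK : compact (X `&` [set z : 'rV[R]_n | `|z| <= C * M]).
  apply: bounded_closed_compact.
    by exists (C * M); split; [exact: num_real|move=> r Mr z [_ /= hz]; exact: le_trans hz (ltW Mr)].
  apply: closedI => //.
  have -> : [set z : 'rV[R]_n | `|z| <= C * M] =
      (fun z : 'rV[R]_n => `|z|) @^-1` [set r | r <= C * M] by [].
  apply: preimage_closed; last exact: closed_le.
  by move=> z _; exact: (@norm_continuous R 'rV[R]_n).
have [_ cgap] := V_cvg Sy0.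
have small e K : 0 < e -> exists k, (K <= k)%N /\ dot (F (xh k)) (xh k - y0) < e.
  apply: (weighted_frequently_small gamma0 gammaoo _ (fun k => gap_ge0 k Sy0) cgap).
  by move=> k; rewrite /gap lerDl divr_ge0 ?sqr_ge0.
(* A subsequence whose midpoints have a gap tending to 0. *)
have [f hf] := choice (fun j => small j.+1%:R^-1 j ltac:(by rewrite invr_gt0)).
have [z [[Xz _] cz]] : (X `&` [set z : 'rV[R]_n | `|z| <= C * M]) `&`
    cluster ((fun j => x (f j)) @ \oo) !=set0.
  apply: cK; exists 0%N => // j _ /=; split; first by have [] := scheme_in (f j).
  by apply: le_trans (hC _) _; rewrite ler_pM2l.
have fz := cluster_frequently cz.
exists z; last first.
  move=> e K e0; have [j [Kj hj]] := fz e K e0; exists (f j); split => //.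
  by apply: leq_trans Kj _; have [] := hf j.
apply: (SVI_of_gap0 Sy0) => //; apply/eqP.
rewrite eq_le (SVI_dual_ge0 Sy0) // andbT; apply/ler_addgt0Pr => e e0; rewrite add0r.
(* A bounds the variation of the gap function per unit distance from z, within
   distance 1. *)
pose A := B / 2 + Ls * (1 + N (z - y0)).
have A0 : 0 < A.
  by rewrite addr_gt0 ?divr_gt0 // mulr_gt0 // ltr_pwDl // is_norm_ge0.
pose dl := Num.min 1 (e / 2 / A).
have dl0 : 0 < dl by rewrite lt_min ltr01 !divr_gt0.
have dl1 : dl <= 1 by rewrite ge_min lexx.
have dlA : dl * A <= e / 2 by rewrite -ler_pdivlMr // ge_min lexx orbT.
have dl20 : 0 < dl / 2 by rewrite divr_gt0.
have [K hK] := midpoint_close dl20.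
have e20 : 0 < e / 2 by rewrite divr_gt0.
have [q _ hq] := near_infty_natSinv_lt (PosNum e20).
have [j [Kj hj]] := fz (dl / 2) (maxn K q) dl20.
have [jf gj] := hf j.
have Kfj : (K <= f j)%N by rewrite (leq_trans _ jf) // (leq_trans _ Kj) // leq_maxl.
have Xb : X (xh (f j)) by have [] := scheme_in (f j).
have zb : N (z - xh (f j)) <= dl.
  have -> : z - xh (f j) = - (x (f j) - z) + (x (f j) - xh (f j)).
    by rewrite opprB addrA subrK.
  apply: le_trans (is_normD normN _ _) _; rewrite is_normN //.
  by have := hK _ Kfj; lra.
have gj2 : dot (F (xh (f j))) (xh (f j) - y0) < e / 2.
  apply: lt_trans gj _; apply: (hq j); rewrite /=.
  by rewrite (leq_trans _ Kj) // leq_maxr.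
apply: le_trans (gap_continuous y0 Xz Xb) _.
suff : N (z - xh (f j)) * (B / 2 + Ls * (N (z - xh (f j)) + N (z - y0))) <= e / 2 by lra.
apply: le_trans dlA; apply: ler_pM => //; first exact: is_norm_ge0.
  by rewrite addr_ge0 ?divr_ge0 ?(ltW B0) // mulr_ge0 ?(ltW Ls0) // addr_ge0 ?(is_norm_ge0 normN).
by rewrite lerD2l ler_pM2l // lerD2r (le_trans zb).
Qed.

(** The whole trajectory converges, since its Bregman distance to the cluster
    point z converges and is frequently small. *)
Lemma trajectory_cvg : exists2 z, SVI X F z &
  forall e : R, 0 < e -> exists K, forall k, (K <= k)%N -> N (x k - z) < e.
Proof.
have [z Sz fz] := solution_cluster; exists z => // e e0.
have [Xz _] := Sz; have [cV _] := V_cvg Sz.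
(* Eventually V (x k) z < 3 eta, and N (x k - z) ^+ 2 is at most twice that. *)
pose eta := e ^+ 2 / 6; have eta0 : 0 < eta by rewrite divr_gt0 // exprn_gt0.
have /cvgrPdist_lt /(_ eta eta0) [K _ hK] := cV.
exists K => k Kk.
have r0 : 0 < Num.sqrt eta / LV by rewrite divr_gt0 // sqrtr_gt0.
have [j [Kj hj]] := fz _ K r0.
have Vj : Vdist s (x j) z <= eta.
  have [Xx _] := scheme_in j.
  apply: le_trans (V_upper Xx Xz) _.
  rewrite -exprMn -[leRHS](sqr_sqrtr (ltW eta0)).
  rewrite lerXn2r ?nnegrE ?sqrtr_ge0 ?mulr_ge0 ?(is_norm_ge0 normN) ?(ltW LV0) //.
  by rewrite mulrC -ler_pdivlMr // ltW.
have [Xx _] := scheme_in k.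
have h1 := hK k Kk; have h2 := hK j Kj; have h3 := Vdist_ge theta1 V_lower Xx Xz.
rewrite -(@ltr_pXn2r _ 2) ?nnegrE ?(is_norm_ge0 normN) ?ltW //.
move: h1 h2; rewrite /= !ltr_norml => /andP[h1 h1'] /andP[h2 h2'].
by move: h1 h1' h2 h2' Vj; rewrite /eta; lra.
Qed.

Lemma trajectory_cluster p : cluster (x @ \oo) p -> SVI X F p.
Proof.
move=> cp; have [z Sz hz] := trajectory_cvg.
suff -> : p = z by [].
apply/eqP; rewrite -subr_eq0; apply/eqP; apply: (is_norm_eq0 normN); apply/eqP.
rewrite eq_le (is_norm_ge0 normN) andbT; apply/ler_addgt0Pr => e e0; rewrite add0r.
have e20 : 0 < e / 2 by rewrite divr_gt0.
have [K hK] := hz _ e20; have [k [Kk hk]] := cluster_frequently cp K e20.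
have -> : p - z = - (x k - p) + (x k - z) by rewrite opprB addrA subrK.
apply: le_trans (is_normD normN _ _) _; rewrite is_normN //.
by have := hK _ Kk; lra.
Qed.

End Trajectory.

(** * Conditional moments *)

Lemma cvgn_series_EFin {R : realType} (a : nat -> R) : cvgn (series a) ->
  (\sum_(0 <= k <oo) (a k)%:E)%E = (limn (series a))%:E.
Proof.
move=> ca; rewrite -EFin_lim //; congr (limn _); apply/funext => m /=.
by rewrite sumEFin.
Qed.

Section ConditionalMoments.
Context {R : realType} {d : measure_display} {T : measurableType d}.
Variable P : probability T R.
Implicit Types (f : T -> R) (G : set (set T)).

Local Notation Int f := (P.-integrable [set: T] (EFin \o f)).

Lemma condexp_eq0_integral G f : G `<=` measurable -> condexp_eq0 P G f ->
  Int f /\ forall A, G A -> \int[P]_(t in A) f t = 0.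
Proof.
move=> GT [g [If Ig _ E] g0]; split => // A GA.
have mA := GT _ GA.
rewrite /Rintegral -E // (ae_eq_integral (cst 0%E)) ?integral0 //.
- apply: measurable_funTS; exact: (measurable_int P).
- by apply: filterS g0 => t /= -> _.
Qed.

Lemma condexp_le_integral G f (c : R) : sigma_algebra setT G -> condexp_le P G f c ->
  Int f /\ \int[P]_t f t <= c.
Proof.
move=> [G0 GC _] [g [If Ig _ E] gc]; split => //.
have GT : G setT by have := GC _ G0; rewrite setD0.
rewrite /Rintegral -E //.
pose g' t := Num.min (g t) c.
have mg : measurable_fun setT g by apply/measurable_EFinP; exact: (measurable_int P).
have Ic : Int (cst c) by exact: finite_measure_integrable_cst.
have -> : (\int[P]_t (g t)%:E = \int[P]_t (g' t)%:E)%E.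
  apply: ae_eq_integral => //.
  - exact/measurable_EFinP.
  - by apply/measurable_EFinP; exact: measurable_minr.
  - by apply: filterS gc => t /= gt _; rewrite /g' min_l.
have Ig' : Int g'.
  apply: (@le_integrable _ _ _ _ _ measurableT _ (fun t => (`|g t| + `|c|)%:E)).
  - by apply/measurable_EFinP; exact: measurable_minr.
  - move=> t _ /=; rewrite lee_fin /g' [leRHS]ger0_norm ?addr_ge0 //.
    by case: (leP (g t) c) => _; rewrite ?lerDl ?lerDr.
  - apply: eq_integrable (integrableD measurableT (integrable_norm Ig) (integrable_norm Ic)) => //.
have : \int[P]_t g' t <= \int[P]_t c.
  by apply: le_Rintegral => // t _; rewrite /g' ge_min lexx orbT.
rewrite Rintegral_cst // (_ : fine (P _) = 1) ?mulr1 //.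
exact: (congr1 fine (probability_setT P)).
Qed.

(** Nonnegative terms with summable expectations have almost surely a
    convergent series. *)
Lemma ae_series_cvg (f : nat -> T -> R) (a : nat -> R) : (forall k t, 0 <= f k t) ->
  (forall k, Int (f k)) -> (forall k, \int[P]_t f k t <= a k) ->
  cvgn (series a) -> {ae P, forall t, cvgn (series (f ^~ t))}.
Proof.
move=> f0 If fa ca.
have mf k : measurable_fun setT (EFin \o f k) by exact: (measurable_int P).
have f0' k t : setT t -> (0 <= (EFin \o f k) t)%E by rewrite lee_fin.
have msum : measurable_fun setT (fun t => \sum_(0 <= k <oo) (EFin \o f k) t)%E.
  by apply: ge0_emeasurable_sum => // k t _ _; exact: f0'.
have Isum : P.-integrable setT (fun t => \sum_(0 <= k <oo) (EFin \o f k) t)%E.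
  apply/integrableP; split => //.
  under eq_integral.
    move=> t _; rewrite gee0_abs; last by apply: nneseries_ge0 => k _ _; exact: f0'.
    over.
  rewrite integral_nneseries //.
  apply: (@le_lt_trans _ _ (\sum_(0 <= k <oo) (a k)%:E)%E).
    apply: lee_nneseries => [k _ _|k _]; first by apply: integral_ge0 => t _; exact: f0'.
    rewrite -[leLHS]fineK ?lee_fin; first exact: fa.
    exact: integrable_fin_num.
  by rewrite cvgn_series_EFin // ltry.
have := integrable_ae measurableT Isum; apply: filterS => t /(_ I) ht.
apply: nnseries_is_cvg => //.
by move: ht; rewrite ge0_fin_numE //; apply: nneseries_ge0 => k _ _; exact: f0'.
Qed.

End ConditionalMoments.

(** * Measurability of the iterates with respect to the histories *)

Section Histories.
Context {R : realType} {n : nat} {dO dT : measure_display}.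
Context {Omega : measurableType dO} {T : measurableType dT}.
Variables (x0 : T -> 'rV[R]_n) (om omh : nat -> T -> Omega).

Lemma hist_sigma_algebra k : sigma_algebra setT (hist x0 om omh k).
Proof. exact: smallest_sigma_algebra. Qed.

Lemma hist_half_sigma_algebra k : sigma_algebra setT (hist_half x0 om omh k).
Proof. exact: smallest_sigma_algebra. Qed.

Lemma hist_sub_half k : hist x0 om omh k `<=` hist_half x0 om omh k.
Proof. by move=> A hA; apply: sub_sigma_algebra; left. Qed.

Lemma hist_half_sub k : hist_half x0 om omh k `<=` hist x0 om omh k.+1.
Proof.
apply: smallest_sub; first exact: hist_sigma_algebra.
move=> A [|hA]; last by apply: sub_sigma_algebra; right; exists k => //=; left.
apply: smallest_sub; first exact: hist_sigma_algebra.
move=> {}A [hA|[i /= ik hA]]; apply: sub_sigma_algebra; first by left.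
by right; exists i => //=; exact: ltnW.
Qed.

Lemma hist_adapted_x0 : adapted (hist x0 om omh 0) (x0 : T -> borel_rV R n).
Proof.
move=> _ B mB; apply: sub_sigma_algebra; apply: sub_sigma_algebra; left.
by exists B.
Qed.

Lemma hist_half_adapted k : adapted (hist_half x0 om omh k) (om k).
Proof.
move=> _ B mB; apply: sub_sigma_algebra; apply: sub_sigma_algebra; right.
by exists B.
Qed.

Lemma histS_adapted k : adapted (hist x0 om omh k.+1) (omh k).
Proof.
move=> _ B mB; apply: sub_sigma_algebra; apply: sub_sigma_algebra; right.
by exists k => //=; right; exists B.
Qed.

Hypothesis mx0 : measurable_fun setT (x0 : T -> borel_rV R n).
Hypothesis mom : forall k, measurable_fun setT (om k).
Hypothesis momh : forall k, measurable_fun setT (omh k).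

Lemma hist_measurable k : hist x0 om omh k `<=` measurable.
Proof.
apply: smallest_sub; first exact: sigma_algebra_measurable.
move=> _ [[B mB <-]|[i _ [[B mB <-]|[B mB <-]]]].
- exact: mx0.
- exact: mom.
- exact: momh.
Qed.

Lemma hist_half_measurable k : hist_half x0 om omh k `<=` measurable.
Proof.
apply: smallest_sub; first exact: sigma_algebra_measurable.
move=> A [|[B mB <-]]; [exact: hist_measurable|exact: mom].
Qed.

End Histories.

Section Iterates.
Context {R : realType} {n d : nat} (N : 'rV[R]_n -> R) (X : set 'rV[R]_n).
Context (s : 'rV[R]_n -> R) (LV theta : R).
Hypothesis normN : is_norm N.
Hypothesis closedX : closed X.
Hypothesis convX : convex_set X.
Hypothesis theta1 : 1 <= theta.
Hypothesis V_lower : forall y z, X y -> X z ->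
  theta / 2 * N (y - z) ^+ 2 <= Vdist s y z.
Hypothesis LV0 : 0 < LV.
Hypothesis grad_lip : forall y z, X y -> X z ->
  dual_norm N (grad s y - grad s z) <= LV * N (y - z).
Hypothesis V_upper : forall y z, X y -> X z ->
  Vdist s y z <= LV ^+ 2 * N (y - z) ^+ 2.

Section OneStep.
Context {dS : measure_display} {S : measurableType dS}.
Implicit Types (y r z : S -> borel_rV R n).

Lemma prox_measurable y r z : (forall t, X (y t)) ->
  (forall t, prox X s (y t) (r t) (z t)) ->
  measurable_fun setT y -> measurable_fun setT r -> measurable_fun setT z.
Proof.
move=> Xy pz my mr.
have [C C0 hC] := is_norm_upper normN; have [D D0 hD] := dual_norm_upper normN.
have [E E0 hE] := is_norm_lower normN.
apply: (rV_measurable_factor (rV_measurable_row_mx my mr)) => t e e0.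
pose A := D + LV * C + 1.
have LC : 0 < LV * C by exact: mulr_gt0.
have A0 : 0 < A by rewrite /A; lra.
exists (e / E / A) => [|t']; first by rewrite !divr_gt0.
set u : 'rV[R]_n := y t; set u' : 'rV[R]_n := y t'.
set w : 'rV[R]_n := r t; set w' : 'rV[R]_n := r t'.
rewrite opp_row_mx add_row_mx => h.
have h1 : `|u - u'| < e / E / A.
  apply: normr_row_lt => [|i]; first by rewrite !divr_gt0.
  by apply: le_lt_trans h; have := normr_coord (row_mx (u - u') (w - w')) (lshift n i); rewrite row_mxEl.
have h2 : `|w - w'| < e / E / A.
  apply: normr_row_lt => [|i]; first by rewrite !divr_gt0.
  by apply: le_lt_trans h; have := normr_coord (row_mx (u - u') (w - w')) (rshift n i); rewrite row_mxEr.
have hp := prox_lipschitz normN convX theta1 V_lower LV0 grad_lip V_upper (Xy t) (Xy t') (pz t) (pz t').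
apply: le_lt_trans (hE _) _; rewrite mulrC -ltr_pdivlMr //.
apply: le_lt_trans hp _; rewrite -/u -/u' -/w -/w'.
have k1 : D * `|w - w'| <= D * (e / E / A) by rewrite ler_pM2l // ltW.
have k2 : LV * (C * `|u - u'|) <= LV * (C * (e / E / A)) by rewrite !ler_pM2l // ltW.
have k3 : LV * N (u - u') <= LV * (C * `|u - u'|) by rewrite ler_pM2l.
have k4 := hD (w - w').
have q0 : 0 < e / E / A by rewrite !divr_gt0.
have k5 : (e / E / A) * A = e / E by rewrite divfK // gt_eqF.
have k6 : (e / E / A) * A = D * (e / E / A) + LV * (C * (e / E / A)) + e / E / A.
  by rewrite /A; ring.
rewrite -k5 k6.
apply: (@le_lt_trans _ _ (D * (e / E / A) + LV * (C * (e / E / A)))); last by rewrite ltrDl.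
by apply: lerD; [exact: le_trans k4 k1|exact: le_trans k3 k2].
Qed.

(** The weights that make the recursion for the Bregman distance multiplicative. *)
Lemma relative_weight_measurable y (z : 'rV[R]_n) i : (forall t, X (y t)) -> X z ->
  measurable_fun setT y ->
  measurable_fun setT (fun t => (z 0 i - (y t : 'rV[R]_n) 0 i) / (1 + Vdist s (y t) z)).
Proof.
move=> Xy Xz my; apply: measurable_funM.
  by apply: measurable_funB => //; exact: rV_measurable_coord.
have [C C0 hC] := is_norm_upper normN.
apply: (real_measurable_factor my) => t e e0.
set u : 'rV[R]_n := y t.
pose A := LV ^+ 2 + LV * (1 + N (u - z)) + 1.
have Nu : 0 <= N (u - z) by exact: is_norm_ge0.
have A0 : 0 < A.
  have : 0 <= LV * (1 + N (u - z)) by rewrite mulr_ge0 ?(ltW LV0) ?addr_ge0.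
  have := sqr_ge0 LV; rewrite /A; lra.
pose dl := Num.min 1 (e / A).
have dl0 : 0 < dl by rewrite lt_min ltr01 divr_gt0.
exists (dl / C) => [|t']; first by rewrite divr_gt0.
set u' : 'rV[R]_n := y t'; rewrite ltr_pdivlMr // => h.
have Nd : N (u - u') < dl by apply: le_lt_trans (hC _) _; rewrite mulrC.
have N0 : 0 <= N (u - u') by exact: is_norm_ge0.
have dl1 : dl <= 1 by rewrite ge_min lexx.
have dlA : dl * A <= e by rewrite -ler_pdivlMr // ge_min lexx orbT.
have V0 : 0 <= Vdist s u z by exact: Vdist_ge0 theta1 V_lower _ _ (Xy t) Xz.
have V0' : 0 <= Vdist s u' z by exact: Vdist_ge0 theta1 V_lower _ _ (Xy t') Xz.
have hV := Vdist_lipschitz normN theta1 V_lower grad_lip V_upper (Xy t) (Xy t') Xz.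
have hinv : `|(1 + Vdist s u z)^-1 - (1 + Vdist s u' z)^-1| <= `|Vdist s u z - Vdist s u' z|.
  have -> : (1 + Vdist s u z)^-1 - (1 + Vdist s u' z)^-1 =
      (Vdist s u' z - Vdist s u z) / ((1 + Vdist s u z) * (1 + Vdist s u' z)).
    by field; rewrite !gt_eqF // ltr_pwDl.
  have V1 : 1 <= (1 + Vdist s u z) * (1 + Vdist s u' z) by rewrite mulr_ege1 // lerDl.
  have V1' := lt_le_trans ltr01 V1.
  by rewrite normrM distrC ler_piMr // ger0_norm ?invr_ge0 ?(ltW V1') // invf_le1.
apply: le_lt_trans hinv _; apply: le_lt_trans hV _; rewrite -/u -/u'.
have hu : N (u' - z) <= 1 + N (u - z).
  have -> : u' - z = - (u - u') + (u - z) by rewrite opprB addrA subrK.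
  apply: le_trans (is_normD normN _ _) _; rewrite is_normN // lerD2r.
  by rewrite ltW // (lt_le_trans Nd).
apply: lt_le_trans dlA.
apply: (@le_lt_trans _ _ (dl * (LV ^+ 2 + LV * (1 + N (u - z))))); last first.
  by rewrite ltr_pM2l // /A ltrDl.
apply: ler_pM => //.
- by rewrite addr_ge0 ?mulr_ge0 ?sqr_ge0 ?(ltW LV0) ?(is_norm_ge0 normN).
- by rewrite ltW.
apply: lerD; last by rewrite ler_pM2l.
by rewrite ler_piMr ?sqr_ge0 // ltW // (lt_le_trans Nd).
Qed.

Context {dO : measure_display} {Omega : measurableType dO}.
Variables (xi : Omega -> 'rV[R]_d) (Fs : 'rV[R]_n -> 'rV[R]_d -> 'rV[R]_n).
Hypothesis mxi : measurable_fun setT (xi : Omega -> borel_rV R d).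
Hypothesis mFs : measurable_fun (X `*` setT : set (borel_rV R n * borel_rV R d))
    ((fun p => Fs p.1 p.2) : borel_rV R n * borel_rV R d -> borel_rV R n).

Lemma sample_measurable y (o : S -> Omega) : (forall t, X (y t)) ->
  measurable_fun setT y -> measurable_fun setT o ->
  measurable_fun setT ((fun t => Fs (y t) (xi (o t))) : S -> borel_rV R n).
Proof.
move=> Xy my mo.
have mX : measurable (X : set (borel_rV R n)).
  rewrite -(setCK X); apply: measurableC; apply: sub_sigma_algebra.
  exact: closed_openC.
have mXT : measurable (X `*` setT : set (borel_rV R n * borel_rV R d)).
  exact: measurableX.
apply: (measurable_comp (g := fun t => (y t, xi (o t) : borel_rV R d)) mXT _ mFs).
  by move=> _ [t _ <-]; split => //; exact: Xy.
apply: measurable_fun_pair => //.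
exact: (measurableT_comp mxi mo).
Qed.

Lemma scale_measurable (a : R) y : measurable_fun setT y ->
  measurable_fun setT ((fun t => a *: (y t : 'rV[R]_n)) : S -> borel_rV R n).
Proof.
move=> my; apply: rV_measurable => i; under eq_fun do rewrite mxE.
by apply: measurable_funM => //; exact: rV_measurable_coord.
Qed.

Lemma noise_measurable (P : probability Omega R) (Ls : R) y (o : S -> Omega) i :
  0 < Ls -> (forall a b, X a -> X b ->
    dual_norm N (mean_map P xi Fs a - mean_map P xi Fs b) <= Ls * N (a - b)) ->
  (forall t, X (y t)) -> measurable_fun setT y -> measurable_fun setT o ->
  measurable_fun setT (fun t => noise P xi Fs y o t 0 i).
Proof.
move=> Ls0 F_lip Xy my mo; rewrite /noise; under eq_fun do rewrite mxE [in X in _ + X]mxE.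
apply: measurable_funB.
  by have := rV_measurable_coord i (sample_measurable Xy my mo).
have [C C0 hC] := is_norm_upper normN; have [D D0 hD] := coord_le_dual normN.
apply: (real_measurable_factor my) => t e e0.
exists (e / (D * (Ls * C))) => [|t']; first by rewrite divr_gt0 // !mulr_gt0.
set u : 'rV[R]_n := y t; set u' : 'rV[R]_n := y t'.
rewrite ltr_pdivlMr ?mulr_gt0 // => h.
have := hD (mean_map P xi Fs u - mean_map P xi Fs u') i; rewrite mxE [in X in _ + X]mxE.
move=> /le_lt_trans; apply; apply: le_lt_trans h.
rewrite [leRHS]mulrC -mulrA ler_pM2l //.
apply: le_trans (F_lip _ _ (Xy _) (Xy _)) _.
by rewrite -mulrA ler_pM2l // hC.
Qed.

End OneStep.

Context {dO dT : measure_display} {Omega : measurableType dO} {T : measurableType dT}.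
Variables (xi : Omega -> 'rV[R]_d) (Fs : 'rV[R]_n -> 'rV[R]_d -> 'rV[R]_n).
Hypothesis mxi : measurable_fun setT (xi : Omega -> borel_rV R d).
Hypothesis mFs : measurable_fun (X `*` setT : set (borel_rV R n * borel_rV R d))
    ((fun p => Fs p.1 p.2) : borel_rV R n * borel_rV R d -> borel_rV R n).
Variables (gamma : nat -> R) (om omh : nat -> T -> Omega) (x xh : nat -> T -> 'rV[R]_n).
Hypothesis scheme : MPSA X s xi Fs gamma om omh x xh.

Lemma MPSA_in k t : X (x k t) /\ X (xh k t).
Proof.
have [X0 st] := scheme.
have Xx : X (x k t) by case: k => // k; have [_ /prox_sub] := st k t.
by split => //; have [/prox_sub] := st k t.
Qed.

(** Each iterate is determined by the history that precedes its own sample. *)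
Lemma iterates_adapted k :
  adapted (hist (x 0%N) om omh k) (x k : T -> borel_rV R n) /\
  adapted (hist_half (x 0%N) om omh k) (xh k : T -> borel_rV R n).
Proof.
have [_ st] := scheme.
have half j : adapted (hist (x 0%N) om omh j) (x j : T -> borel_rV R n) ->
    adapted (hist_half (x 0%N) om omh j) (xh j : T -> borel_rV R n).
  move=> aj; have aj' : adapted (hist_half (x 0%N) om omh j) (x j : T -> borel_rV R n).
    apply: adapted_sub aj => A /hist_sub_half hA; exact: sub_sigma_algebra.
  have Xj t : X (x j t) by have [] := MPSA_in j t.
  apply: (prox_measurable (S := g_sigma_algebraType (hist_half (x 0%N) om omh j))
    Xj (fun t => (st j t).1)) => //.
  apply: scale_measurable.
  apply: (sample_measurable (S := g_sigma_algebraType (hist_half (x 0%N) om omh j))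
    mxi mFs Xj aj').
  exact: hist_half_adapted.
suff ax : adapted (hist (x 0%N) om omh k) (x k : T -> borel_rV R n).
  by split => //; exact: half.
elim: k => [|k ih]; first exact: hist_adapted_x0.
have ih' : adapted (hist (x 0%N) om omh k.+1) (x k : T -> borel_rV R n).
  apply: adapted_sub ih => A /hist_sub_half/hist_half_sub hA; exact: sub_sigma_algebra.
have ihh : adapted (hist (x 0%N) om omh k.+1) (xh k : T -> borel_rV R n).
  apply: adapted_sub (half k ih) => A /hist_half_sub hA; exact: sub_sigma_algebra.
have Xk t : X (x k t) by have [] := MPSA_in k t.
have Xhk t : X (xh k t) by have [] := MPSA_in k t.
apply: (prox_measurable (S := g_sigma_algebraType (hist (x 0%N) om omh k.+1))
    Xk (fun t => (st k t).2)) => //.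
apply: scale_measurable.
apply: (sample_measurable (S := g_sigma_algebraType (hist (x 0%N) om omh k.+1))
  mxi mFs Xhk ihh).
exact: histS_adapted.
Qed.

End Iterates.

(** * Almost sure convergence of weighted noise *)

Section WeightedNoise.
Context {R : realType} {d : measure_display} {T : measurableType d}.
Variables (P : probability T R) (G : nat -> set (set T)).
Variables (w q : nat -> T -> R) (gamma : nat -> R) (K c : R).

Local Notation Int f := (P.-integrable [set: T] (EFin \o f)).

Hypothesis sG : forall k, sigma_algebra setT (G k).
Hypothesis GT : forall k, G k `<=` measurable.
Hypothesis GS : forall k, G k `<=` G k.+1.
Hypothesis Iw : forall k, Int (w k).
Hypothesis w0 : forall k A, G k A -> \int[P]_(t in A) w k t = 0.
Hypothesis aw : forall k, adapted (G k.+1) (w k).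
Hypothesis Iq : forall k, Int (q k).
Hypothesis qc : forall k, \int[P]_t q k t <= c.
Hypothesis K0 : 0 <= K.
Hypothesis wq : forall k t, w k t ^+ 2 <= K * q k t.
Hypothesis cgamma : cvgn (series (fun k => gamma k ^+ 2)).

(** Bounded predictable weights preserve the martingale property, and the
    variances are dominated by the squared steplengths. *)
Lemma weighted_noise_cvg (phi : nat -> T -> R) (M : R) :
  (forall k, adapted (G k) (phi k)) -> (forall k t, `|phi k t| <= M) ->
  {ae P, forall t, cvgn (series (fun k => gamma k * phi k t * w k t))}.
Proof.
move=> aphi phiM.
have a1 k : adapted (G k) (fun t => gamma k * phi k t) by exact: measurable_funM.
have b1 k t : `|gamma k * phi k t| <= `|gamma k| * M by rewrite normrM ler_wpM2l.
have ID k : Int (fun t => gamma k * phi k t * w k t).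
  apply: eq_integrable (integrableM_bounded (Iw k) (adapted_measurable (@GT k) (a1 k)) (b1 k)) => //.
  by move=> t _ /=; rewrite mulrC.
have b2 k t : (gamma k * phi k t * w k t) ^+ 2 <= gamma k ^+ 2 * (M ^+ 2 * K) * q k t.
  have -> : (gamma k * phi k t * w k t) ^+ 2 =
    gamma k ^+ 2 * (phi k t ^+ 2 * w k t ^+ 2) by ring.
  rewrite -(mulrA (gamma k ^+ 2)) -(mulrA (M ^+ 2)); apply: ler_wpM2l; first exact: sqr_ge0.
  apply: ler_pM => //; try exact: sqr_ge0.
  by rewrite -[leLHS]real_normK ?num_real // lerXn2r ?nnegrE // (le_trans _ (phiM k t)).
have IDq k : Int (fun t => gamma k ^+ 2 * (M ^+ 2 * K) * q k t).
  by apply: eq_integrable (integrableZl measurableT (gamma k ^+ 2 * (M ^+ 2 * K)) (Iq k)) => // t _.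
have ID2 k : Int (fun t => (gamma k * phi k t * w k t) ^+ 2).
  apply: le_integrable (IDq k) => //.
    apply/measurable_EFinP; apply: measurable_funX.
    by apply/measurable_EFinP; exact: (measurable_int P).
  move=> t _ /=; rewrite lee_fin ger0_norm ?sqr_ge0 //.
  exact: le_trans (b2 k t) (ler_norm _).
apply: (@martingale_series_cvg _ _ _ P G (fun k t => gamma k * phi k t * w k t)
  (fun k => (M ^+ 2 * K * c) * gamma k ^+ 2)) => //.
- move=> k h L ah hL.
  transitivity (\int[P]_t (w k t * (gamma k * phi k t * h t))).
    by apply: eq_Rintegral => t _; ring.
  apply: (Rintegral_orthogonal (M := `|gamma k| * M * L) (sG k) (@GT k) (Iw k) (@w0 k)).
    exact: measurable_funM.
  by move=> t; rewrite normrM; apply: ler_pM.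
- move=> k; apply: measurable_funM => //.
  by apply: adapted_sub (a1 k) => A /GS hA; exact: sub_sigma_algebra.
- move=> k; apply: le_trans (le_Rintegral measurableT (ID2 k) (IDq k) (fun t _ => b2 k t)) _.
  rewrite RintegralZl // (mulrC (M ^+ 2 * K * c)) -(mulrA (gamma k ^+ 2)).
  apply: ler_wpM2l; first exact: sqr_ge0.
  by apply: ler_wpM2l => //; rewrite mulr_ge0 ?sqr_ge0.
- exact: cvg_seriesZ.
Qed.

End WeightedNoise.

(** * The mirror-prox scheme *)

Theorem proposition4 (R : realType) (n d : nat)
  (N : 'rV[R]_n -> R) (X : set 'rV[R]_n)
  (dO : measure_display) (Omega : measurableType dO) (PO : probability Omega R)
  (xi : Omega -> 'rV[R]_d) (Fs : 'rV[R]_n -> 'rV[R]_d -> 'rV[R]_n)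
  (s : 'rV[R]_n -> R) (theta LV : R) (gamma : nat -> R)
  (dT : measure_display) (T : measurableType dT) (P : probability T R)
  (om omh : nat -> T -> Omega) (x xh : nat -> T -> 'rV[R]_n)
  (beta c : R)
  (F := mean_map PO xi Fs)
  (w := fun k => noise PO xi Fs (x k) (om k))
  (wh := fun k => noise PO xi Fs (xh k) (omh k))
  (Fk := hist (x 0%N) om omh)
  (Fkh := hist_half (x 0%N) om omh) :
  is_norm N ->
  X !=set0 -> closed X -> convex_set X ->
  (* the stochastic map *)
  measurable_fun setT (xi : Omega -> borel_rV R d) ->
  measurable_fun (X `*` setT : set (borel_rV R n * borel_rV R d))
    ((fun p => Fs p.1 p.2) : borel_rV R n * borel_rV R d -> borel_rV R n) ->
  (forall y j, X y -> PO.-integrable setT (fun o => (Fs y (xi o) 0 j)%:E)) ->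
  (* the prox function *)
  (forall y, X y -> differentiable s y) ->
  strongly_convex N X s ->
  1 <= theta ->
  (forall y z, X y -> X z -> theta / 2 * N (y - z) ^+ 2 <= Vdist s y z) ->
  0 < LV ->
  (forall y z, X y -> X z ->
     dual_norm N (grad s y - grad s z) <= LV * N (y - z)) ->
  (forall y z, X y -> X z -> Vdist s y z <= LV ^+ 2 * N (y - z) ^+ 2) ->
  (* the steplengths, the samples and the iterates *)
  (forall k, 0 < gamma k) -> gamma @ \oo --> 0 ->
  measurable_fun setT (x 0%N : T -> borel_rV R n) ->
  (forall k, measurable_fun setT (om k)) ->
  (forall k, measurable_fun setT (omh k)) ->
  MPSA X s xi Fs gamma om omh x xh ->
  (* assumptions on the problem *)
  pseudomonotone_plus X F ->
  SVI X F !=set0 ->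
  (* (A1) *)
  (forall k j, condexp_eq0 P (Fk k) (fun t => w k t 0 j) /\
               condexp_eq0 P (Fkh k) (fun t => wh k t 0 j)) ->
  (* (A2) *)
  (exists2 nu : R, 0 < nu & forall k,
     condexp_le P (Fk k) (fun t => N (w k t) ^+ 2) (nu ^+ 2) /\
     condexp_le P (Fkh k) (fun t => N (wh k t) ^+ 2) (nu ^+ 2)) ->
  (* (A3) *)
  (\sum_(0 <= k <oo) (gamma k ^+ 2)%:E < +oo)%E ->
  (* (A4) *)
  (\sum_(0 <= k <oo) (gamma k)%:E = +oo)%E ->
  (* (A6) *)
  (exists Ls Bs : R, [/\ 0 < Ls, 0 < Bs,
     forall y z, X y -> X z -> dual_norm N (F y - F z) <= Ls * N (y - z)
   & forall y, X y -> dual_norm N (F y) <= Bs / 2]) ->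
  (* (A7) *)
  (exists2 nus : R, 0 < nus & forall k,
     condexp_le P (Fk k) (fun t => dual_norm N (w k t) ^+ 2) (nus ^+ 2) /\
     condexp_le P (Fkh k) (fun t => dual_norm N (wh k t) ^+ 2) (nus ^+ 2)) ->
  0 < beta -> 0 < c -> 0 <= theta / 2 - 1 / c ->
  {ae P, forall t,
     (exists M : R, forall k, N (x k t) <= M) /\
     (forall p, cluster ((fun k => x k t) @ \oo) p -> SVI X F p)}.
Proof.
move=> normN _ closedX convX mxi mFs _ _ _ theta1 V_lower LV0 grad_lip V_upper.
move=> gamma0 _ mx0 mom momh scheme F_pm [y0 Sy0] A1 _ A3 A4.
move=> [Ls [B [Ls0 B0 F_lip F_bnd]]] [nus nus0 A7] _ _ _.
have [Xy0 _] := Sy0.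
have sF k : sigma_algebra setT (Fk k) by exact: hist_sigma_algebra.
have sFh k : sigma_algebra setT (Fkh k) by exact: hist_half_sigma_algebra.
have FkhT k : Fkh k `<=` measurable by exact: hist_half_measurable.
have FkhS k : Fkh k `<=` Fkh k.+1.
  by apply: subset_trans (@hist_half_sub _ _ _ _ _ _ _ _ _ k) _; exact: hist_sub_half.
have Xx k t : X (x k t) by have [] := MPSA_in scheme k t.
have Xxh k t : X (xh k t) by have [] := MPSA_in scheme k t.
have iter_adapted := iterates_adapted normN closedX convX theta1 V_lower LV0 grad_lip
  V_upper mxi mFs scheme.
have ax k : adapted (Fkh k) (x k : T -> borel_rV R n).
  have [axk _] := iter_adapted k.
  by apply: adapted_sub axk => A /hist_sub_half hA; exact: sub_sigma_algebra.
have awh k i : adapted (Fkh k.+1) (fun t => wh k t 0 i).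
  have [_ axh] := iter_adapted k.
  suff h : adapted (Fk k.+1) (fun t => wh k t 0 i).
    by apply: adapted_sub h => A /hist_sub_half hA; exact: sub_sigma_algebra.
  apply: (noise_measurable (S := g_sigma_algebraType (Fk k.+1)) normN closedX mxi mFs
    i Ls0 F_lip (Xxh k)).
    by apply: adapted_sub axh => A /hist_half_sub hA; exact: sub_sigma_algebra.
  exact: histS_adapted.
have wh_orth k i := condexp_eq0_integral (@FkhT k) (A1 k i).2.
have w2 k := condexp_le_integral (sF k) (A7 k).1.
have wh2 k := condexp_le_integral (sFh k) (A7 k).2.
have cgamma : cvgn (series (fun k => gamma k ^+ 2)).
  by apply: nnseries_is_cvg => // k; exact: sqr_ge0.
have [C C0 hC] := coord_le_dual normN.
have weighted (phi : nat -> T -> R) (M : R) i :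
    (forall k, adapted (Fkh k) (phi k)) -> (forall k t, `|phi k t| <= M) ->
    {ae P, forall t, cvgn (series (fun k => gamma k * phi k t * wh k t 0 i))}.
  apply: (@weighted_noise_cvg _ _ _ P Fkh (fun k t => wh k t 0 i)
    (fun k t => dual_norm N (wh k t) ^+ 2) gamma (C ^+ 2) (nus ^+ 2)) => //.
  - by move=> k; have [] := wh_orth k i.
  - by move=> k; have [] := wh_orth k i.
  - by move=> k; have [] := wh2 k.
  - by move=> k; have [] := wh2 k.
  - exact: sqr_ge0.
  - move=> k t; rewrite -exprMn -[leLHS]real_normK ?num_real //.
    by rewrite lerXn2r ?nnegrE ?mulr_ge0 ?(ltW C0) ?(dual_norm_ge0 normN).
pose q k t := B ^+ 2 + dual_norm N (w k t) ^+ 2 + dual_norm N (wh k t) ^+ 2.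
have Bint : P.-integrable setT (EFin \o cst (B ^+ 2)) by exact: finite_measure_integrable_cst.
have q1int k : P.-integrable setT (EFin \o (fun t => B ^+ 2 + dual_norm N (w k t) ^+ 2)).
  by apply: eq_integrable (integrableD measurableT Bint (w2 k).1).
have qint k : P.-integrable setT (EFin \o q k).
  by apply: eq_integrable (integrableD measurableT (q1int k) (wh2 k).1).
have qle k : \int[P]_t q k t <= B ^+ 2 + nus ^+ 2 + nus ^+ 2.
  rewrite RintegralD ?(wh2 k).1 // RintegralD ?(w2 k).1 //.
  rewrite Rintegral_cst // (_ : fine (P _) = 1) ?mulr1; last first.
    exact: (congr1 fine (probability_setT P)).
  by apply: lerD (wh2 k).2; rewrite lerD2l (w2 k).2.
have err_cvg : {ae P, forall t, cvgn (series (fun k => 3 * (gamma k ^+ 2 * q k t)))}.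
  have Z k : P.-integrable setT (EFin \o (fun t => gamma k ^+ 2 * q k t)).
    by apply: eq_integrable (integrableZl measurableT (gamma k ^+ 2) (qint k)).
  apply: (@ae_series_cvg _ _ _ P (fun k t => 3 * (gamma k ^+ 2 * q k t))
    (fun k => 3 * (B ^+ 2 + nus ^+ 2 + nus ^+ 2) * gamma k ^+ 2)).
  - move=> k t; apply: mulr_ge0 => //; apply: mulr_ge0; first exact: sqr_ge0.
    by rewrite !addr_ge0 ?sqr_ge0.
  - by move=> k; apply: eq_integrable (integrableZl measurableT 3 (Z k)).
  - move=> k; rewrite RintegralZl // RintegralZl // -mulrA ler_pM2l // mulrC.
    by rewrite ler_wpM2r ?sqr_ge0.
  - exact: cvg_seriesZ.
have noise_ae : {ae P, forall t, forall i : 'I_n,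
    cvgn (series (fun k => gamma k * 1 * wh k t 0 i))}.
  apply: filter_forall => i; apply: (weighted (fun _ _ => 1) 1) => //.
  by move=> _ _; rewrite normr1.
have clamp_ae : {ae P, forall t, forall m : nat, forall i : 'I_n,
    cvgn (series (fun k => gamma k * clamp m (x k t 0 i) * wh k t 0 i))}.
  apply: ae_foralln => m; apply: filter_forall => i.
  apply: (weighted (fun k t => clamp m (x k t 0 i)) m%:R) => [k|k t]; last exact: clamp_bound.
  apply: (real_measurable_factor (ax k)) => t e e0; exists e => // t' h.
  apply: le_lt_trans (clamp_lipschitz _ _ _) _; apply: le_lt_trans h.
  by have := normr_coord (x k t - x k t') i; rewrite !mxE.
have relative_ae : {ae P, forall t, forall i : 'I_n, cvgn (series (fun k =>
    gamma k * ((y0 0 i - x k t 0 i) / (1 + Vdist s (x k t) y0)) * wh k t 0 i))}.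
  have [E E0 hE] := is_norm_lower normN.
  apply: filter_forall => i.
  apply: (weighted (fun k t => (y0 0 i - x k t 0 i) / (1 + Vdist s (x k t) y0)) E).
    move=> k; apply: (relative_weight_measurable (S := g_sigma_algebraType (Fkh k))
      normN theta1 V_lower LV0 grad_lip V_upper i (Xx k) Xy0 (ax k)).
  move=> k t.
  have V0 := Vdist_ge0 theta1 V_lower (Xx k t) Xy0.
  have V2 := Vdist_ge theta1 V_lower (Xx k t) Xy0.
  rewrite normrM normfV (ger0_norm (_ : 0 <= 1 + Vdist s (x k t) y0)); last by rewrite addr_ge0.
  rewrite ler_pdivrMr ?ltr_pwDl //.
  have := normr_coord (y0 - x k t) i; rewrite !mxE => /le_trans; apply.
  apply: le_trans (hE _) _; rewrite ler_pM2l // (is_normB normN).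
  have := sqr_ge0 (N (x k t - y0) - 1); move: V2; rewrite !expr2; lra.
have gammaoo : ~ cvgn (series gamma).
  by move=> /cvgn_series_EFin; rewrite A4.
apply: filterS3 noise_ae clamp_ae (filterI relative_ae err_cvg) => t h1 h2 [h3 h4].
have st k : prox X s (x k t) (gamma k *: (F (x k t) + w k t)) (xh k t) /\
    prox X s (x k t) (gamma k *: (F (xh k t) + wh k t)) (x k.+1 t).
  by rewrite /w /wh /noise !(addrC (F _)) !subrK; exact: scheme.2.
split.
  exact: (trajectory_bounded normN convX theta1 V_lower V_upper F_bnd F_pm gamma0
    (Xx 0%N t) st Sy0 h4 h3).
move=> p; exact: (trajectory_cluster normN closedX convX theta1 V_lower LV0 V_upper
  Ls0 B0 F_lip F_bnd F_pm gamma0 gammaoo (Xx 0%N t) st Sy0 h4 h1 h2 h3).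
Qed.
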